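(* Let $d\ge 1$, let $\mathbf{k}=(k_1,\dots,k_d)\in\mathbb{N}_0^d$, and let $n\ge|\mathbf{k}|$ be an integer. Let $a,b,\beta,\mu$ be real parameters with $a>0$, $b+|\mathbf{k}|>0$, $\mu>-\tfrac12$ and $2|\mathbf{k}|+2\mu+\beta+d>0$. For $(t,\boldsymbol{x})=(t,x_1,\dots,x_d)\in\mathbb{R}^{d+1}$ put $$g_{n,\mathbf{k}}(t,\boldsymbol{x};a,b,\beta,\mu)=\prod_{j=1}^{d}(1-\tanh^2x_j)^{a+\frac{d-j}{4}}\;\mathsf{L}^{\beta,\mu}_{\mathbf{k},n}(\tau_1,\dots,\tau_{d+1})\;\exp\!\left(-\tfrac{e^t}{2}+bt\right),$$ where $\tau_1=e^t$, $\tau_{j+1}=e^t\tanh x_j\prod_{i=1}^{j-1}\sqrt{1-\tanh^2x_i}$ for $1\le j\le d$, and $\mathsf{L}^{\beta,\mu}_{\mathbf{k},n}$ is the Laguerre polynomial on the cone defined in the context. Then for all real $\xi_1,\dots,\xi_{d+1}$ the Fourier transform $$\mathcal{F}(g_{n,\mathbf{k}})(\xi_1,\dots,\xi_{d+1})=\int_{\mathbb{R}^{d+1}}e^{-i(\xi_1x_1+\cdots+\xi_dx_d+\xi_{d+1}t)}g_{n,\mathbf{k}}(t,\boldsymbol{x};a,b,\beta,\mu)\,d\boldsymbol{x}\,dt$$ is given by $$\mathcal{F}(g_{n,\mathbf{k}})=2^{\,b+|\mathbf{k}|-i\xi_{d+1}+2ad+\frac{d(d-5)}{4}+\sum_{j=1}^{d-1}jk_{j+1}}\;\frac{(2|\mathbf{k}|+2\mu+\beta+d)_{n-|\mathbf{k}|}\,\Gamma(b+|\mathbf{k}|-i\xi_{d+1})}{(n-|\mathbf{k}|)!}$$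 $$\times\prod_{j=1}^{d}\left\{\frac{\left(2\left(|\mathbf{k}^{j+1}|+\mu+\frac{d-j}{2}\right)\right)_{k_j}}{k_j!}\,\Theta_j^d(a,\mu,\mathbf{k};\xi_j)\right\}\Lambda(n,\mathbf{k},b,\mu,\beta,\xi_{d+1}),$$ where $$\Lambda(n,\mathbf{k},b,\mu,\beta,\xi_{d+1})={}_2F_1\!\left(\begin{matrix}-n+|\mathbf{k}|,\ b+|\mathbf{k}|-i\xi_{d+1}\\ 2|\mathbf{k}|+2\mu+\beta+d\end{matrix}\,\Big|\,2\right)$$ and $$\Theta_j^d(a,\mu,\mathbf{k};\xi_j)=B\!\left(a+\tfrac{|\mathbf{k}^{j+1}|+i\xi_j}{2}+\tfrac{d-j}{4},\;a+\tfrac{|\mathbf{k}^{j+1}|-i\xi_j}{2}+\tfrac{d-j}{4}\right)$$ $$\times{}_3F_2\!\left(\begin{matrix}-k_j,\ k_j+2\left(|\mathbf{k}^{j+1}|+\mu+\frac{d-j}{2}\right),\ a+\frac{|\mathbf{k}^{j+1}|+i\xi_j}{2}+\frac{d-j}{4}\\ |\mathbf{k}^{j+1}|+\mu+\frac{d-j+1}{2},\ |\mathbf{k}^{j+1}|+2a+\frac{d-j}{2}\end{matrix}\,\Big|\,1\right).$$ Equivalently, in terms of the continuous Hahn polynomials $p_k$, $$\Theta_j^d(a,\mu,\mathbf{k};\xi_j)=\frac{k_j!}{i^{k_j}\left(|\mathbf{k}^{j+1}|+\mu+\frac{d-j+1}{2}\right)_{k_j}\left(|\mathbf{k}^{j+1}|+2a+\frac{d-j}{2}\right)_{k_j}}$$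 $$\times B\!\left(a+\tfrac{|\mathbf{k}^{j+1}|+i\xi_j}{2}+\tfrac{d-j}{4},\;a+\tfrac{|\mathbf{k}^{j+1}|-i\xi_j}{2}+\tfrac{d-j}{4}\right)p_{k_j}\!\left(\tfrac{\xi_j}{2};\,A_j,\,M_j,\,M_j,\,A_j\right),$$ where $A_j=a+\frac{|\mathbf{k}^{j+1}|}{2}+\frac{d-j}{4}$ and $M_j=\mu-a+\frac{|\mathbf{k}^{j+1}|+1}{2}+\frac{d-j}{4}$.
   Context: Notation: $\mathbb{N}_0=\{0,1,2,\dots\}$; $|\mathbf{k}|=k_1+\cdots+k_d$; $|\mathbf{k}^{j}|=k_j+\cdots+k_d$ for $1\le j\le d$, and $|\mathbf{k}^{d+1}|=0$. The symbol $i$ is the imaginary unit (when not used as an index). Pochhammer symbol: $(\alpha)_0=1$, $(\alpha)_n=\alpha(\alpha+1)\cdots(\alpha+n-1)$ for $n\ge1$. Hypergeometric function: ${}_pF_q\!\left(\begin{matrix}a_1,\dots,a_p\\ b_1,\dots,b_q\end{matrix}\Big|x\right)=\sum_{n\ge0}\frac{(a_1)_n\cdots(a_p)_n}{(b_1)_n\cdots(b_q)_n}\frac{x^n}{n!}$ (all series used here terminate, having a nonpositive integer upper parameter). $B(x,y)=\Gamma(x)\Gamma(y)/\Gamma(x+y)$ is the beta function. Gegenbauer polynomials: $C_n^{(\lambda)}(x)=\frac{(2\lambda)_n}{n!}\,{}_2F_1\!\left(\begin{matrix}-n,\ n+2\lambda\\ \lambda+\frac12\end{matrix}\Big|\frac{1-x}{2}\right)$.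 Laguerre polynomials: $L_n^{\alpha}(t)=\frac{(\alpha+1)_n}{n!}\,{}_1F_1\!\left(\begin{matrix}-n\\ \alpha+1\end{matrix}\Big|t\right)$, $\alpha>-1$. Ball polynomials: for $\boldsymbol{x}=(x_1,\dots,x_d)$, with $\boldsymbol{x}_0=0$, $\boldsymbol{x}_j=(x_1,\dots,x_j)$ and $\|\cdot\|$ the Euclidean norm, $$P_{\mathbf{k}}^{\mu}(\boldsymbol{x})=\prod_{j=1}^d(1-\|\boldsymbol{x}_{j-1}\|^2)^{k_j/2}\,C_{k_j}^{(\lambda_j)}\!\left(\frac{x_j}{\sqrt{1-\|\boldsymbol{x}_{j-1}\|^2}}\right),\qquad \lambda_j=\mu+|\mathbf{k}^{j+1}|+\frac{d-j}{2}.$$ Laguerre polynomials on the cone: for $|\mathbf{k}|\le n$, $$\mathsf{L}^{\beta,\mu}_{\mathbf{k},n}(t,\boldsymbol{x})=L_{n-|\mathbf{k}|}^{2|\mathbf{k}|+2\mu+\beta+d-1}(t)\;t^{|\mathbf{k}|}\,P_{\mathbf{k}}^{\mu}\!\left(\frac{\boldsymbol{x}}{t}\right).$$ Continuous Hahn polynomials: $$p_k(x;a,b,c,d)=i^k\frac{(a+c)_k(a+d)_k}{k!}\,{}_3F_2\!\left(\begin{matrix}-k,\ k+a+b+c+d-1,\ a+ix\\ a+c,\ a+d\end{matrix}\Big|1\right).$$ *)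

(* Defs.v *)
From HB Require Import structures.
From mathcomp Require Import all_boot all_order all_algebra.
From mathcomp Require Import all_classical all_reals all_analysis.
From mathcomp Require Import complex.
Set Implicit Arguments.
Unset Strict Implicit.
Unset Printing Implicit Defensive.
Import Order.TTheory GRing.Theory Num.Theory.
Import numFieldNormedType.Exports.
Local Open Scope classical_set_scope.
Local Open Scope ring_scope.
Local Open Scope complex_scope.

Section cons_measure.
Context d (T : measurableType d) (R : realType) (n : nat).
Variables (m : {sigma_finite_measure set T -> \bar R})
          (mu : {sigma_finite_measure set (n.-tuple T) -> \bar R}).

Definition tcons (p : T * n.-tuple T) : n.+1.-tuple T := [tuple of p.1 :: p.2].

Lemma measurable_tcons : measurable_fun [set: T * n.-tuple T] tcons.
Proof. exact: measurable_cons. Qed.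

Definition cons_measure : set (n.+1.-tuple T) -> \bar R :=
  pushforward (m \x mu)%E tcons.

Let mcons (A : set (n.+1.-tuple T)) : measurable A ->
  measurable (tcons @^-1` A).
Proof. by move=> mA; rewrite -[X in measurable X]setTI; exact: measurable_tcons. Qed.

Let cons_measure0 : cons_measure set0 = 0%E.
Proof. by rewrite /cons_measure /pushforward preimage_set0 measure0. Qed.

Let cons_measure_ge0 A : (0 <= cons_measure A)%E.
Proof. by rewrite /cons_measure /pushforward; exact: measure_ge0. Qed.

Let cons_measure_sigma_additive : semi_sigma_additive cons_measure.
Proof.
move=> F mF tF mUF; rewrite /cons_measure /pushforward preimage_bigcup.
apply: measure_semi_sigma_additive.
- by move=> i; exact: mcons.
- apply/trivIsetP => /= i j _ _ ij; rewrite -preimage_setI.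
  by move/trivIsetP : tF => /(_ _ _ _ _ ij) ->//; rewrite preimage_set0.
- by rewrite -preimage_bigcup; exact: mcons.
Qed.

HB.instance Definition _ := isMeasure.Build _ _ _ cons_measure
  cons_measure0 cons_measure_ge0 cons_measure_sigma_additive.

Let cons_measure_sigma_finite : sigma_finite setT cons_measure.
Proof.
pose un (z : n.+1.-tuple T) : T * n.-tuple T := (thead z, [tuple of behead z]).
have consK p : un (tcons p) = p.
  by case: p => x v; congr pair; apply/val_inj.
have mun : measurable_fun setT un.
  apply/measurable_fun_pair => //=.
    exact: (measurable_tnth ord0).
  exact: measurable_behead.
have /sigma_finiteP[F [TF ndF Foo]] := sigma_finiteT m.
have /sigma_finiteP[G [TG ndG Goo]] := sigma_finiteT mu.
exists (fun i => un @^-1` (F i `*` G i)).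
  rewrite -preimage_bigcup -[LHS](preimage_setT un); congr (_ @^-1` _).
  rewrite -setXTT TF TG predeqE => -[x y]; split.
    move=> [/= [p _ Fpx] [q _ Gqy]]; exists (maxn p q) => //; split.
    - by move: x Fpx; exact/subsetPset/ndF/leq_maxl.
    - by move: y Gqy; exact/subsetPset/ndG/leq_maxr.
  by move=> [p _ []/= ? ?]; split; exists p.
move=> i; have [mFi Fi] := Foo i; have [mGi Gi] := Goo i; split.
  by rewrite -[X in measurable X]setTI; apply: mun => //; exact: measurableX.
rewrite /cons_measure /pushforward -comp_preimage.
rewrite [X in X @^-1` _](_ : _ = id); last by apply/funext => p /=.
by rewrite preimage_id product_measure1E// lte_mul_pinfty// ge0_fin_numE.
Qed.

HB.instance Definition _ := Measure_isSigmaFinite.Build _ _ _ cons_measure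
  cons_measure_sigma_finite.

End cons_measure.

(* In dimension [0] the space is a single point, of mass [1]. *)
Fixpoint lebesgue_tuple (R : realType) (n : nat) :
    {sigma_finite_measure set (n.-tuple (measurableTypeR R)) -> \bar R} :=
  match n with
  | 0 => \d_([tuple] : 0.-tuple (measurableTypeR R))
  | n'.+1 => cons_measure (@lebesgue_measure R) (lebesgue_tuple R n')
  end.

Section complex_functions.
Context (R : realType).
Local Notation C := R[i].

Definition cexp (z : C) : C :=
  (expR (complex.Re z))%:C * (cos (complex.Im z) +i* sin (complex.Im z)).

(* Meant for a base [x > 0]. *)
Definition cpow (x : R) (z : C) : C := cexp (z * (ln x)%:C).

Definition cintegral d (T : measurableType d)
    (mu : {measure set T -> \bar R}) (D : set T) (f : T -> C) : C :=
  (\int[mu]_(x in D) complex.Re (f x)) +i* (\int[mu]_(x in D) complex.Im (f x)).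

Definition fourier n (f : n.-tuple (measurableTypeR R) -> C) (xi : n.-tuple R) : C :=
  cintegral (lebesgue_tuple R n) setT
    (fun z => cexp (- 'i%C * (\sum_(j < n) tnth xi j * tnth z j)%:C) * f z).

(* Euler's integral: this is the Gamma function on the half-plane [Re z > 0],
   which contains all the arguments at which it is used. *)
Definition cGamma (z : C) : C :=
  cintegral (@lebesgue_measure R) `]0, +oo[
    (fun s => cpow s (z - 1) * (expR (- s))%:C).

Definition cBeta (z w : C) : C := cGamma z * cGamma w / cGamma (z + w).

Definition tanh (x : R) : R := (expR x - expR (- x)) / (expR x + expR (- x)).

End complex_functions.

Definition pochhammer (K : numFieldType) (x : K) (n : nat) : K :=
  \prod_(i < n) (x + i%:R).

(* [hypergeom s r x] is the series pFq with upper parameters [s] and lower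
   parameters [r]. *)
Definition hypergeom (K : numFieldType) (s r : seq K) (x : K) : K :=
  limn (series (fun m =>
    (\prod_(a <- s) pochhammer a m) / (\prod_(b <- r) pochhammer b m)
      * (x ^+ m / m`!%:R))).

Section polynomials.
Context (R : realType).

Definition gegenbauer (n : nat) (la x : R) : R :=
  pochhammer (2 * la) n / n`!%:R *
  hypergeom [:: - n%:R; n%:R + 2 * la] [:: la + 2^-1] ((1 - x) / 2).

Definition laguerre (n : nat) (alpha t : R) : R :=
  pochhammer (alpha + 1) n / n`!%:R *
  hypergeom [:: - n%:R] [:: alpha + 1] t.

Definition continuous_hahn (k : nat) (x a b c d : R[i]) : R[i] :=
  'i%C ^+ k * (pochhammer (a + c) k * pochhammer (a + d) k / k`!%:R) *
  hypergeom [:: - k%:R; k%:R + a + b + c + d - 1; a + 'i%C * x]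
            [:: a + c; a + d] 1.

End polynomials.

(* Coordinates are numbered from [0]: an index [j : 'I_d] stands for the usual
   index [j + 1] in [{1, ..., d}]. *)
Section cone.
Context (R : realType) (d : nat).
Implicit Types (k : 'I_d -> nat) (x : 'I_d -> R) (j : 'I_d).

Definition ksum k : nat := \sum_(i < d) k i.

(* The sum of the entries strictly after [j]; this is |k^{j+1}| for the usual
   (one-based) numbering of [j]. *)
Definition ktail k j : nat := \sum_(i < d | (j < i)%N) k i.

(* [d - j] for the usual (one-based) numbering of [j]. *)
Definition codim j : R := (d - j.+1)%N%:R.

(* The squared norm of the vector of the coordinates strictly before [j]. *)
Definition sqnorm_before x j : R := \sum_(i < d | (i < j)%N) x i ^+ 2.

Definition gegen_index (mu : R) k j : R := mu + (ktail k j)%:R + codim j / 2.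

Definition ball_poly (mu : R) k x : R :=
  \prod_(j < d)
    ((1 - sqnorm_before x j) `^ ((k j)%:R / 2) *
     gegenbauer (k j) (gegen_index mu k j)
       (x j / Num.sqrt (1 - sqnorm_before x j))).

Definition cone_laguerre (beta mu : R) k (n : nat) (t : R) x : R :=
  laguerre (n - ksum k) (2 * (ksum k)%:R + 2 * mu + beta + d%:R - 1) t *
  t ^+ ksum k * ball_poly mu k (fun j => x j / t).

Definition tau x (t : R) j : R :=
  expR t * tanh (x j) * \prod_(i < d | (i < j)%N) Num.sqrt (1 - tanh (x i) ^+ 2).

Definition gfun (n : nat) k (t : R) x (a b beta mu : R) : R :=
  (\prod_(j < d) (1 - tanh (x j) ^+ 2) `^ (a + codim j / 4)) *
  cone_laguerre beta mu k n (expR t) (tau x t) *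
  expR (- (expR t / 2) + b * t).

End cone.

Section factors.
Context (R : realType) (d : nat).
Implicit Types (k : 'I_d -> nat) (j : 'I_d).

Definition LambdaF (n : nat) k (b mu beta xi : R) : R[i] :=
  hypergeom [:: - n%:R + (ksum k)%:R; (b + (ksum k)%:R)%:C - 'i%C * xi%:C]
            [:: (2 * (ksum k)%:R + 2 * mu + beta + d%:R)%:C] 2.

Definition theta_arg (a : R) k j (xi : R) : R[i] :=
  a%:C + ((ktail k j)%:R + 'i%C * xi%:C) / 2 + (codim R j / 4)%:C.

Definition ThetaF (a mu : R) k j (xi : R) : R[i] :=
  cBeta (theta_arg a k j xi) (theta_arg a k j (- xi)) *
  hypergeom
    [:: - (k j)%:R;
        (k j)%:R + (2 * ((ktail k j)%:R + mu + codim R j / 2))%:C;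
        theta_arg a k j xi]
    [:: ((ktail k j)%:R + mu + (codim R j + 1) / 2)%:C;
        ((ktail k j)%:R + 2 * a + codim R j / 2)%:C] 1.

End factors.

(* Main.v *)
Require Import Defs.
From mathcomp Require Import all_boot all_order all_algebra.
From mathcomp Require Import all_classical all_reals all_analysis.
From mathcomp Require Import complex measurable_realfun ring lra.
Set Implicit Arguments.
Unset Strict Implicit.
Unset Printing Implicit Defensive.
Import Order.TTheory GRing.Theory Num.Theory.
Import numFieldNormedType.Exports.
Local Open Scope classical_set_scope.
Local Open Scope ring_scope.
Local Open Scope complex_scope.
Import ComplexField.Normc.

(** The integrand separates. Put s_i = 1 - tanh^2 x_i. The point of the ball at
    which the polynomial is evaluated has coordinates
    y_j = tanh x_j * sqrt (s_1 ... s_(j-1)), so 1 - |y_1, ..., y_(j-1)|^2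
    telescopes to s_1 ... s_(j-1) ([spherical_sum]). Hence the j-th Gegenbauer
    polynomial is evaluated at tanh x_j, and the powers with exponents k_j / 2
    regroup into powers of the single s_i with exponents |k^{i+1}| / 2
    ([ball_poly_separates]). So g is a product of functions of one variable
    ([gfun_separates]), and by Fubini its Fourier transform is a product of
    d + 1 one-dimensional ones ([cintegral_lebesgue_tuple]).

    Each of these is computed by expanding the terminating series and
    integrating term by term. In the variable t the terms are
    exp (c t - e^t / 2), and Gamma(c) is the integral of exp (c t - e^t) over
    the line, so a translation by ln 2 gives 2^c Gamma(c)
    ([fourier_laguerre_factor]). In the variable x_j, since
    (1 - tanh x) / 2 = 1 / (1 + e^(2x)), the terms become
    e^(z v) (1 + e^v)^(-(z+w)) with v = 2x, whose integral is B(z, w)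
    ([fourier_gegenbauer_factor]). The recurrence Gamma(z + 1) = z Gamma(z)
    ([cGammaS]) turns the dependence on the summation index into Pochhammer
    symbols, and the sums are again terminating hypergeometric series.

    The Beta integral with complex parameters ([cGammaM]) needs only Fubini and
    translations: Gamma(z) Gamma(w) is the integral over the plane of
    exp (z s + w t - e^s - e^t); substitute s = v + t, then translate t by
    - ln (1 + e^v), which turns e^t + e^(v+t) into e^t.

    The formula with continuous Hahn polynomials has the same
    hypergeometric series, the factors in front of it being non-zero. *)

(** * The complex exponential *)

Section cexp.
Context (R : realType).
Implicit Types (z w : R[i]) (x : R).

Lemma cexpD z w : cexp (z + w) = cexp z * cexp w.
Proof.
case: z w => [a b] [c d]; rewrite /cexp /=.
rewrite expRD cosD sinD; apply/eqP; rewrite eq_complex /=.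
by apply/andP; split; apply/eqP; ring.
Qed.

Lemma cexp_real x : cexp x%:C = (expR x)%:C.
Proof. by rewrite /cexp /= cos0 sin0 mulr1. Qed.

Lemma cexp0 : cexp (0 : R[i]) = 1.
Proof. by rewrite (_ : 0 = (0 : R)%:C) // cexp_real expR0. Qed.

Lemma cexp_sum (I : finType) (F : I -> R[i]) :
  cexp (\sum_i F i) = \prod_i cexp (F i).
Proof. exact: (big_morph _ cexpD cexp0). Qed.

Lemma normc_cexp z : normc (cexp z) = expR (complex.Re z).
Proof.
rewrite /cexp normcM /= expr0n addr0 sqrtr_sqr ger0_norm ?expR_ge0 //.
by rewrite cos2Dsin2 sqrtr1 mulr1.
Qed.

Lemma cReM z w : complex.Re (z * w) =
  complex.Re z * complex.Re w - complex.Im z * complex.Im w.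
Proof. by case: z w => [a b] [c d]. Qed.
Lemma cImM z w : complex.Im (z * w) =
  complex.Re z * complex.Im w + complex.Im z * complex.Re w.
Proof. by case: z w => [a b] [c d]. Qed.
Lemma cReD z w : complex.Re (z + w) = complex.Re z + complex.Re w.
Proof. by case: z w => [a b] [c d]. Qed.
Lemma cImD z w : complex.Im (z + w) = complex.Im z + complex.Im w.
Proof. by case: z w => [a b] [c d]. Qed.

Lemma cReB z w : complex.Re (z - w) = complex.Re z - complex.Re w.
Proof. by case: z w => [a b] [c d]. Qed.
Lemma cImB z w : complex.Im (z - w) = complex.Im z - complex.Im w.
Proof. by case: z w => [a b] [c d]. Qed.
Lemma cReMr z x : complex.Re (z * x%:C) = complex.Re z * x.
Proof. by rewrite cReM /= mulr0 subr0. Qed.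
Lemma cImMr z x : complex.Im (z * x%:C) = complex.Im z * x.
Proof. by rewrite cImM /= mulr0 add0r. Qed.
Lemma Re_cexp z : complex.Re (cexp z) = expR (complex.Re z) * cos (complex.Im z).
Proof. by rewrite /cexp cReM /= mul0r subr0. Qed.
Lemma Im_cexp z : complex.Im (cexp z) = expR (complex.Re z) * sin (complex.Im z).
Proof. by rewrite /cexp cImM /= mul0r addr0. Qed.

Lemma Re_le_normc z : `|complex.Re z| <= normc z.
Proof.
case: z => a b /=; rewrite -(sqrtr_sqr a) ler_sqrt ?lerDl ?sqr_ge0 //.
by rewrite addr_ge0 // sqr_ge0.
Qed.
Lemma Im_le_normc z : `|complex.Im z| <= normc z.
Proof.
case: z => a b /=; rewrite -(sqrtr_sqr b) ler_sqrt ?lerDr ?sqr_ge0 //.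
by rewrite addr_ge0 // sqr_ge0.
Qed.
End cexp.

(** * Integration of complex-valued functions *)

Section cintegrable.
Context d (T : measurableType d) (R : realType).
Variable mu : {measure set T -> \bar R}.
Implicit Types (f g : T -> R[i]).

Definition cmeasurable f :=
  measurable_fun setT (@complex.Re R \o f) /\
  measurable_fun setT (@complex.Im R \o f).

Definition cintegrable f :=
  mu.-integrable setT (EFin \o (@complex.Re R \o f)) /\
  mu.-integrable setT (EFin \o (@complex.Im R \o f)).

Lemma cintegrable_dominated f (h : T -> R) : cmeasurable f ->
  mu.-integrable setT (EFin \o h) -> (forall x, normc (f x) <= h x) ->
  cintegrable f.
Proof.
move=> [mr mi] ih fh; split.
  apply: (le_integrable measurableT _ _ ih); first exact/measurable_EFinP.
  move=> x _ /=; rewrite lee_fin; apply: (le_trans (Re_le_normc _)).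
  by rewrite (le_trans (fh x))// ler_norm.
apply: (le_integrable measurableT _ _ ih); first exact/measurable_EFinP.
move=> x _ /=; rewrite lee_fin; apply: (le_trans (Im_le_normc _)).
by rewrite (le_trans (fh x))// ler_norm.
Qed.

Lemma cintegrableD f g : cintegrable f -> cintegrable g ->
  cintegrable (fun x => f x + g x).
Proof.
move=> [fr fi] [gr gi]; split.
  apply: eq_integrable (integrableD measurableT fr gr) => //.
  by move=> x _ /=; rewrite cReD.
apply: eq_integrable (integrableD measurableT fi gi) => //.
by move=> x _ /=; rewrite cImD.
Qed.

Lemma cintegralD f g : cintegrable f -> cintegrable g ->
  cintegral mu setT (fun x => f x + g x) =
  cintegral mu setT f + cintegral mu setT g.
Proof.
move=> [fr fi] [gr gi]; rewrite /cintegral.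
under eq_Rintegral do rewrite cReD.
under [X in _ +i* X]eq_Rintegral do rewrite cImD.
by rewrite !RintegralD.
Qed.

Lemma cintegrableZ (c : R[i]) f : cintegrable f -> cintegrable (fun x => c * f x).
Proof.
move=> [fr fi].
have Z (r : R) (h : T -> R) : mu.-integrable setT (EFin \o h) ->
    mu.-integrable setT (EFin \o (fun x => r * h x)).
  by move=> /(integrableZl measurableT r).
split.
  apply: eq_integrable (integrableB measurableT (Z (complex.Re c) _ fr)
    (Z (complex.Im c) _ fi)) => //.
  by move=> x _ /=; rewrite cReM.
apply: eq_integrable (integrableD measurableT (Z (complex.Re c) _ fi)
    (Z (complex.Im c) _ fr)) => //.
by move=> x _ /=; rewrite cImM.
Qed.

Lemma cintegralZ (c : R[i]) f : cintegrable f ->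
  cintegral mu setT (fun x => c * f x) = c * cintegral mu setT f.
Proof.
move=> [fr fi]; rewrite /cintegral.
have Z (r : R) (h : T -> R) : mu.-integrable setT (EFin \o h) ->
    mu.-integrable setT (EFin \o (fun x => r * h x)).
  by move=> /(integrableZl measurableT r).
under eq_Rintegral do rewrite cReM.
under [X in _ +i* X]eq_Rintegral do rewrite cImM.
rewrite RintegralB //; [|exact: Z..].
rewrite RintegralD //; [|exact: Z..].
rewrite !RintegralZl //.
by case: c => ? ?.
Qed.

Lemma eq_cintegral f g : f =1 g -> cintegral mu setT f = cintegral mu setT g.
Proof. by move=> /funext ->. Qed.

Lemma eq_cintegrable f g : f =1 g -> cintegrable f -> cintegrable g.
Proof. by move=> /funext ->. Qed.

Lemma cintegrable0 : cintegrable (fun=> 0).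
Proof. by split; exact: integrable0. Qed.

Lemma cintegral0 : cintegral mu setT (fun=> 0) = 0.
Proof.
rewrite /cintegral /Rintegral /=.
by rewrite integral0.
Qed.

Lemma cintegrable_sum n (F : 'I_n -> T -> R[i]) :
  (forall i, cintegrable (F i)) -> cintegrable (fun x => \sum_(i < n) F i x).
Proof.
elim: n F => [|n IH] F iF.
  apply: (@eq_cintegrable (fun=> 0)); last exact: cintegrable0.
  by move=> x; rewrite big_ord0.
apply: (@eq_cintegrable
    (fun x => \sum_(i < n) F (widen_ord (leqnSn n) i) x + F ord_max x)).
  by move=> x; rewrite big_ord_recr.
by apply: cintegrableD => //; apply: IH => i; exact: iF.
Qed.

Lemma cintegral_sum n (F : 'I_n -> T -> R[i]) :
  (forall i, cintegrable (F i)) ->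
  cintegral mu setT (fun x => \sum_(i < n) F i x) =
  \sum_(i < n) cintegral mu setT (F i).
Proof.
elim: n F => [|n IH] F iF.
  rewrite big_ord0; transitivity (cintegral mu setT (fun=> 0)).
    by apply: eq_cintegral => x; rewrite big_ord0.
  exact: cintegral0.
rewrite big_ord_recr /= -IH // -cintegralD //; last first.
  by apply: cintegrable_sum => i; exact: iF.
by apply: eq_cintegral => x; rewrite big_ord_recr.
Qed.

End cintegrable.

Section cmeasurable.
Context (R : realType).

Lemma cmeasurable_cexp d (T : measurableType d) (f : T -> R[i]) :
  cmeasurable f -> cmeasurable (fun x => cexp (f x)).
Proof.
move=> [mr mi]; split.
  apply: (@eq_measurable_fun _ _ _ _ _
      (fun x => expR (complex.Re (f x)) * cos (complex.Im (f x)))).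
    by move=> x _; exact/esym/Re_cexp.
  apply: measurable_funM; first exact: (measurableT_comp (@measurable_expR R) mr).
  apply: (measurableT_comp _ mi).
  exact: (continuous_measurable_fun (@continuous_cos R)).
apply: (@eq_measurable_fun _ _ _ _ _
    (fun x => expR (complex.Re (f x)) * sin (complex.Im (f x)))).
  by move=> x _; exact/esym/Im_cexp.
apply: measurable_funM; first exact: (measurableT_comp (@measurable_expR R) mr).
apply: (measurableT_comp _ mi).
exact: (continuous_measurable_fun (@continuous_sin R)).
Qed.

Lemma cmeasurableM d (T : measurableType d) (f g : T -> R[i]) :
  cmeasurable f -> cmeasurable g -> cmeasurable (fun x => f x * g x).
Proof.
move=> [fr fi] [gr gi]; split.
  apply: (@eq_measurable_fun _ _ _ _ _ (fun x =>
      complex.Re (f x) * complex.Re (g x) - complex.Im (f x) * complex.Im (g x))).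
    by move=> x _; exact/esym/cReM.
  by apply: measurable_funB; apply: measurable_funM.
apply: (@eq_measurable_fun _ _ _ _ _ (fun x =>
    complex.Re (f x) * complex.Im (g x) + complex.Im (f x) * complex.Re (g x))).
  by move=> x _; exact/esym/cImM.
by apply: measurable_funD; apply: measurable_funM.
Qed.

Lemma cmeasurable_comp d1 (T1 : measurableType d1) d2 (T2 : measurableType d2)
  (f : T2 -> R[i]) (g : T1 -> T2) :
  cmeasurable f -> measurable_fun setT g -> cmeasurable (fun x => f (g x)).
Proof.
move=> [fr fi] mg.
by split; [exact: (measurableT_comp fr mg)|exact: (measurableT_comp fi mg)].
Qed.

Lemma cmeasurable_prod d (T : measurableType d) n (G : 'I_n -> T -> R[i]) :
  (forall j, cmeasurable (G j)) -> cmeasurable (fun x => \prod_(j < n) G j x).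
Proof.
elim: n G => [|n IH] G mG.
  rewrite (_ : (fun x => _) = fun=> 1); last by apply/funext => x; rewrite big_ord0.
  by split; exact: measurable_cst.
rewrite (_ : (fun x => _) = fun x =>
    G ord0 x * \prod_(j < n) G (lift ord0 j) x); last first.
  by apply/funext => x; rewrite big_ord_recl.
by apply: cmeasurableM => //; apply: IH => j; exact: mG.
Qed.

Lemma cintegrable_cmeasurable d (T : measurableType d)
    (nu : {measure set T -> \bar R}) (f : T -> R[i]) :
  cintegrable nu f -> cmeasurable f.
Proof.
move=> [fr fi]; split; apply/measurable_EFinP.
  exact: measurable_int fr.
exact: measurable_int fi.
Qed.

End cmeasurable.

(** * Product measures *)

Section product.
Context d1 d2 (T1 : measurableType d1) (T2 : measurableType d2) (R : realType).
Variables (m1 : {sigma_finite_measure set T1 -> \bar R})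
          (m2 : {sigma_finite_measure set T2 -> \bar R}).

Lemma integrable_tensor (f : T1 -> R) (g : T2 -> R) :
  m1.-integrable setT (EFin \o f) -> m2.-integrable setT (EFin \o g) ->
  (m1 \x m2)%E.-integrable setT (EFin \o (fun p => f p.1 * g p.2)).
Proof.
move=> fi gi.
have mf : measurable_fun setT f by apply/measurable_EFinP; exact: measurable_int fi.
have mg : measurable_fun setT g by apply/measurable_EFinP; exact: measurable_int gi.
apply/integrable12ltyP.
  apply/measurable_EFinP; apply: measurable_funM.
    exact: (measurableT_comp mf measurable_fst).
  exact: (measurableT_comp mg measurable_snd).
have ng : (\int[m2]_y `|(g y)%:E|)%E \is a fin_num.
  have /integrableP[_ gy] := gi.
  by rewrite ge0_fin_numE //; apply: integral_ge0.
rewrite (eq_integral (fun x => (`|(f x)%:E| * \int[m2]_y `|(g y)%:E|)%E)); last first.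
  move=> x _ /=; rewrite -ge0_integralZl //=; last first.
    by apply/measurable_EFinP; exact: measurableT_comp.
  by apply: eq_integral => y _; rewrite /= normrM EFinM.
rewrite -(fineK ng) ge0_integralZr //; last 2 first.
  by apply/measurable_EFinP; exact: measurableT_comp.
  by rewrite lee_fin fine_ge0 //; apply: integral_ge0.
apply: lte_mul_pinfty => //; first by apply: integral_ge0.
  rewrite ge0_fin_numE //; last by apply: integral_ge0.
  by have /integrableP[_ ] := fi.
by rewrite ltry.
Qed.

Lemma Rintegral_tensor (f : T1 -> R) (g : T2 -> R) :
  m1.-integrable setT (EFin \o f) -> m2.-integrable setT (EFin \o g) ->
  \int[(m1 \x m2)%E]_p (f p.1 * g p.2) = (\int[m1]_x f x) * (\int[m2]_y g y).
Proof.
move=> fi gi; rewrite /Rintegral -integral12_prod_meas1; last exact: integrable_tensor.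
rewrite /fubini_F /=.
rewrite (eq_integral (fun x => ((f x)%:E * (\int[m2]_y g y)%:E)%E)); last first.
  move=> x _ /=; rewrite /Rintegral fineK; last exact: integrable_fin_num.
  rewrite -integralZl //.
have gfin : (\int[m2]_y (g y)%:E)%E \is a fin_num by exact: integrable_fin_num.
by rewrite integralZr // fineM //; exact: integrable_fin_num.
Qed.

Lemma cintegrable_tensor (f : T1 -> R[i]) (g : T2 -> R[i]) :
  cintegrable m1 f -> cintegrable m2 g ->
  cintegrable (m1 \x m2)%E (fun p => f p.1 * g p.2).
Proof.
move=> [fr fi] [gr gi]; split.
  apply: eq_integrable (integrableB measurableT (integrable_tensor fr gr)
    (integrable_tensor fi gi)) => //.
  by move=> x _ /=; rewrite cReM.
apply: eq_integrable (integrableD measurableT (integrable_tensor fr gi)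
    (integrable_tensor fi gr)) => //.
by move=> x _ /=; rewrite cImM.
Qed.

Lemma cintegral_tensor (f : T1 -> R[i]) (g : T2 -> R[i]) :
  cintegrable m1 f -> cintegrable m2 g ->
  cintegral (m1 \x m2)%E setT (fun p => f p.1 * g p.2) =
  cintegral m1 setT f * cintegral m2 setT g.
Proof.
move=> [fr fi] [gr gi]; apply/eqP; rewrite eq_complex /=.
apply/andP; split; apply/eqP.
  rewrite -(Rintegral_tensor fr gr) -(Rintegral_tensor fi gi).
  rewrite -(RintegralB measurableT (integrable_tensor fr gr) (integrable_tensor fi gi)).
  by apply: eq_Rintegral => p _; rewrite cReM.
rewrite -(Rintegral_tensor fr gi) -(Rintegral_tensor fi gr).
rewrite -(RintegralD measurableT (integrable_tensor fr gi) (integrable_tensor fi gr)).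
by apply: eq_Rintegral => p _; rewrite cImM.
Qed.

(** The sections are required to be integrable everywhere, and not only almost
    everywhere, because the real-valued inner integral is meaningful only where
    the extended one is finite. *)
Lemma Rintegral_Fubini (f : T1 * T2 -> R) :
  (m1 \x m2)%E.-integrable setT (EFin \o f) ->
  (forall x, m2.-integrable setT (EFin \o (fun y => f (x, y)))) ->
  (forall y, m1.-integrable setT (EFin \o (fun x => f (x, y)))) ->
  \int[m1]_x \int[m2]_y f (x, y) = \int[m2]_y \int[m1]_x f (x, y).
Proof.
move=> fi f2 f1; rewrite /Rintegral; congr fine.
transitivity (\int[m1]_x \int[m2]_y (EFin \o f) (x, y))%E.
  by apply: eq_integral => x _; rewrite fineK //; exact: integrable_fin_num (f2 x).
rewrite Fubini //.
by apply: eq_integral => y _; rewrite fineK //; exact: integrable_fin_num (f1 y).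
Qed.

Lemma cintegral_Fubini (f : T1 * T2 -> R[i]) :
  cintegrable (m1 \x m2)%E f ->
  (forall x, cintegrable m2 (fun y => f (x, y))) ->
  (forall y, cintegrable m1 (fun x => f (x, y))) ->
  cintegral m1 setT (fun x => cintegral m2 setT (fun y => f (x, y))) =
  cintegral m2 setT (fun y => cintegral m1 setT (fun x => f (x, y))).
Proof.
move=> [fr fi] f2 f1; rewrite /cintegral /=; congr (_ +i* _).
  by apply: (Rintegral_Fubini fr) => [x|y]; [case: (f2 x)|case: (f1 y)].
by apply: (Rintegral_Fubini fi) => [x|y]; [case: (f2 x)|case: (f1 y)].
Qed.
End product.

(** * Affine substitutions on the line *)

Section affine.
Context (R : realType).
Local Notation mu := (@lebesgue_measure R).
Variables (r c : R).
Hypothesis r0 : 0 < r.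

Let phi (x : measurableTypeR R) : measurableTypeR R := r * x + c.

Let mphi : measurable_fun setT phi.
Proof.
apply: measurable_funD => //; exact: measurable_funM.
Qed.

Let nu : {measure set (measurableTypeR R) -> \bar R} :=
  mscale (NngNum (ltW r0))
    (measure_function_pushforward__canonical__measure_function_Measure mu mphi).

(* Lebesgue measure is determined by its values on the half-open intervals. *)
Let lebesgue_affine (A : set R) : measurable A -> mu A = nu A.
Proof.
apply: lebesgue_measure_unique => //= _ [[a b]] _ <-.
rewrite /nu /mscale /= /pushforward.
rewrite (_ : phi @^-1` _ = `](a - c) / r, (b - c) / r]%classic); last first.
  apply/seteqP; split => x /=; rewrite !in_itv /= /phi.
    by move=> /andP[ax xb]; rewrite ltr_pdivrMr // ler_pdivlMr //; apply/andP; split; lra.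
  by rewrite ltr_pdivrMr // ler_pdivlMr // => /andP[ax xb]; apply/andP; split; lra.
rewrite !lebesgue_measure_itv /= !lte_fin ltr_pM2r ?invr_gt0 // ltrD2r.
case: ifPn => _; last by rewrite mule0.
by rewrite -!EFinB -EFinM; congr EFin; field; rewrite gt_eqF.
Qed.

Lemma ge0_integral_affine (f : R -> \bar R) : measurable_fun setT f ->
  (forall x, 0 <= f x)%E ->
  (\int[mu]_x f x = r%:E * \int[mu]_x f (r * x + c)%R)%E.
Proof.
move=> mf f0.
rewrite (eq_measure_integral nu); last first.
  by move=> A mA _; exact: lebesgue_affine.
by rewrite ge0_integral_mscale //= ge0_integral_pushforward.
Qed.

Lemma integrable_affine (f : R -> R) :
  mu.-integrable setT (EFin \o f) ->
  mu.-integrable setT (EFin \o (fun x => f (r * x + c))).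
Proof.
move=> /integrableP[mf fy]; apply/integrableP; split.
  exact: (measurableT_comp mf mphi).
move: fy; rewrite ge0_integral_affine //; last exact: measurableT_comp.
by rewrite -lte_pdivlMl // gt0_muley // lte_fin invr_gt0.
Qed.

Lemma Rintegral_affine (f : R -> R) :
  mu.-integrable setT (EFin \o f) ->
  \int[mu]_x f x = r * \int[mu]_x f (r * x + c).
Proof.
move=> fi; have fia := integrable_affine fi.
have /integrableP[mf fy] := fi.
have P := integrable_pos_fin_num measurableT fia.
have N := integrable_neg_fin_num measurableT fia.
pose g := EFin \o (fun x => f (r * x + c)).
transitivity (fine (r%:E * (\int[mu]_x g^\+ x - \int[mu]_x g^\- x))%E).
  rewrite /Rintegral integralE; congr fine.
  rewrite (ge0_integral_affine (measurable_funepos mf)) //.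
  rewrite (ge0_integral_affine (measurable_funeneg mf)) //.
  rewrite (@muleBr _ r%:E (\int[mu]_x g^\+ x)%E (\int[mu]_x g^\- x)%E) //; last first.
    exact: fin_num_adde_defr.
  by congr (_ * _ - _ * _)%E; apply: eq_integral => x _;
    rewrite ?(funeposE, funenegE).
rewrite -[RHS]/(r * fine (\int[mu]_x g x)%E) [X in _ = r * fine X]integralE.
by rewrite fineM // fin_numB P N.
Qed.

Lemma cintegrable_affine (f : R -> R[i]) : cintegrable mu f ->
  cintegrable mu (fun x => f (r * x + c)).
Proof.
by move=> [fr fi]; split; [exact: integrable_affine fr|exact: integrable_affine fi].
Qed.

Lemma cintegral_affine (f : R -> R[i]) : cintegrable mu f ->
  cintegral mu setT f = r%:C * cintegral mu setT (fun x => f (r * x + c)).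
Proof.
move=> [fr fi]; rewrite /cintegral (Rintegral_affine fr) (Rintegral_affine fi).
by apply/eqP; rewrite eq_complex /=; apply/andP; split; apply/eqP; ring.
Qed.
End affine.

Lemma cintegral_shift (R : realType) (c : R) (f : R -> R[i]) :
  cintegrable (@lebesgue_measure R) f ->
  cintegral (@lebesgue_measure R) setT (fun x => f (x + c)) =
  cintegral (@lebesgue_measure R) setT f.
Proof.
move=> fi; rewrite (cintegral_affine c ltr01 fi) mul1r.
by apply: eq_cintegral => x; rewrite mul1r.
Qed.

Lemma cintegrable_shift (R : realType) (c : R) (f : R -> R[i]) :
  cintegrable (@lebesgue_measure R) f ->
  cintegrable (@lebesgue_measure R) (fun x => f (x + c)).
Proof.
move=> fi; apply: eq_cintegrable (cintegrable_affine c ltr01 fi) => x.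
by rewrite mul1r.
Qed.

(** * Integrals over the real line *)

Section real_line.
Context (R : realType).
Local Notation mu := (@lebesgue_measure R).

Lemma integrable_exp_abs (c : R) : 0 < c ->
  mu.-integrable setT (EFin \o (fun x => expR (- (c * `|x|)))).
Proof.
move=> c0.
have cf : continuous (fun x : R => expR (- (c * `|x|))).
  move=> x; apply: continuous_comp; last exact: continuous_expR.
  by apply: cvgN; apply: cvgM; [exact: cvg_cst|exact: norm_continuous].
have mf : measurable_fun setT (fun x : R => expR (- (c * `|x|))).
  exact: continuous_measurable_fun.
apply/integrableP; split; first exact/measurable_EFinP.
under eq_integral do rewrite /= ger0_norm ?expR_ge0 //.
rewrite (ge0_symfun_integralT (f := fun x : R => expR (- (c * `|x|)))) //; last first.
  by move=> x /=; rewrite normrN.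
rewrite -set_itvcy.
pose F x := - (c^-1 * expR (- (c * x))) : R.
have dF (x : R) : is_derive x (1 : R) F (expR (- (c * x))).
  rewrite /F; apply: is_derive_eq.
  by rewrite /GRing.scale /=; field; rewrite gt_eqF.
suff -> : (\int[mu]_(x in `[0%R, +oo[) (expR (- (c * `|x|)))%:E =
    0%:E - (F 0)%:E)%E by rewrite -EFinB -EFinM ltry.
transitivity (\int[mu]_(x in `[0%R, +oo[) (expR (- (c * x)))%:E)%E.
  by apply: eq_integral => x; rewrite inE /= in_itv /= andbT => x0; rewrite ger0_norm.
apply: ge0_continuous_FTC2y.
- by move=> x _; rewrite expR_ge0.
- apply: continuous_subspaceT => x; apply: continuous_comp; last exact: continuous_expR.
  by apply: cvgN; apply: cvgM; [exact: cvg_cst|exact: cvg_id].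
- rewrite -[X in _ --> X]oppr0 -(mulr0 c^-1).
  apply: cvgN; apply: cvgM; first exact: cvg_cst.
  apply: (cvg_comp (fun x => c * x) (fun y => expR (- y))); last exact: cvgr_expR.
  exact: gt0_cvgMry.
- by move=> x _; case: (dF x).
- apply: cvg_at_right_filter; apply: differentiable_continuous.
  by apply/derivable1_diffP; case: (dF 0).
- by move=> x _; rewrite derive1E derive_val.
Qed.

(** All the kernels below decay exponentially at both ends of the line, which is
    why no other test of integrability is needed. *)
Lemma integrable_decay (c K : R) (f : R -> R) : 0 < c ->
  measurable_fun setT f -> (forall x, `|f x| <= K * expR (- (c * `|x|))) ->
  mu.-integrable setT (EFin \o f).
Proof.
move=> c0 mf fK.
have ih := integrableZl measurableT K (integrable_exp_abs c0).
apply: (le_integrable measurableT _ _ ih); first exact/measurable_EFinP.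
by move=> x _ /=; rewrite lee_fin (le_trans (fK x)) // ler_norm.
Qed.

(** By the fundamental theorem of calculus the integral over [-n, n] is
    F(n) - F(-n); dominated convergence identifies its limit. The integrand may
    change sign, so monotone convergence does not apply. *)
Lemma Rintegral_derive (F f : R -> R) :
  continuous f -> (forall x : R, is_derive x (1 : R) F (f x)) ->
  mu.-integrable setT (EFin \o f) ->
  F n%:R @[n --> \oo] --> (0 : R) -> F (- n%:R) @[n --> \oo] --> (0 : R) ->
  \int[mu]_x f x = 0.
Proof.
move=> cf dF fi F0 FN0.
(* The successor makes the interval non-degenerate, also for n = 0. *)
pose I (n : nat) := `[- n.+1%:R, n.+1%:R]%classic : set R.
have mf : measurable_fun setT f by exact: continuous_measurable_fun.
have [] := @dominated_convergence _ _ _ mu setT measurableT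
  (fun n => (EFin \o f) \_ (I n)) (EFin \o f) (abse \o (EFin \o f)).
- move=> n; apply/(measurable_restrictT (EFin \o f)); first exact: measurable_itv.
  by apply/measurable_EFinP; exact: measurable_funTS.
- exact/measurable_EFinP.
- apply: aeW => x _; apply: cvg_near_cst.
  near=> n; rewrite patchE ifT // inE /I /= in_itv /= -ler_norml.
  have : `|x| <= n%:R by near: n; exact: nbhs_infty_ger.
  by move=> /le_trans; apply; rewrite ler_nat.
- exact: integrable_abse.
- apply: aeW => x n _; rewrite patchE; case: ifP => // _.
  by rewrite (_ : point = 0%E :> \bar R) // abse0 abse_ge0.
move=> _ _ lim1.
have E n : (\int[mu]_x ((EFin \o f) \_ (I n)) x = (F n.+1%:R - F (- n.+1%:R))%:E)%E.
  rewrite -integral_mkcond (@continuous_FTC2 _ f F).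
  - by rewrite EFinB.
  - by rewrite -subr_gt0 opprK -natrD ltr0n.
  - exact: continuous_subspaceT.
  - have cF x : F y @[y --> x] --> F x.
      by apply: differentiable_continuous; apply/derivable1_diffP; case: (dF x).
    split => [x _||]; first by case: (dF x).
      exact: cvg_at_right_filter.
    exact: cvg_at_left_filter.
  - by move=> x _; rewrite derive1E derive_val.
rewrite /Rintegral.
suff -> : (\int[mu]_x (f x)%:E = 0%:E)%E by [].
apply: (cvg_unique _ lim1); first exact: ereal_hausdorff.
move=> /=; under eq_fun do rewrite E.
apply: cvg_EFin; first by apply: nearW => n.
rewrite -[X in _ --> X]subr0; apply: cvgB.
  by rewrite (cvg_shiftS (fun n => F n%:R)).
by rewrite (cvg_shiftS (fun n => F (- n%:R))).
Unshelve. all: end_near. Qed.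

(** The substitution s = e^x. It holds on each [-n, n], which e^x maps onto
    [e^-n, e^n]; the intervals on either side exhaust the domains of
    integration. *)
Lemma ge0_integral_ln (f : R -> R) : continuous f -> (forall x, 0 <= f x) ->
  (\int[mu]_(s in `]0%R, +oo[) (f (ln s) / s)%:E = \int[mu]_x (f x)%:E)%E.
Proof.
move=> cf f0.
pose I (n : nat) := `[- n%:R, n%:R]%classic : set R.
pose J (n : nat) := `[expR (- n%:R), expR n%:R]%classic : set R.
have dexp : expR^`()%classic = expR :> (R -> R).
  by apply/funext => x; rewrite derive1E derive_val.
have mf : measurable_fun setT (fun x => f x) by exact: continuous_measurable_fun.
have cg s : 0 < s -> {for s, continuous (fun s => f (ln s) / s)}.
  move=> sp; apply: cvgM; last by apply: cvgV; [rewrite gt_eqF|exact: cvg_id].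
  by apply: continuous_comp; [exact: continuous_ln|exact: cf].
have mg n : measurable_fun (J n) (fun s => f (ln s) / s).
  apply: (@measurable_funS _ _ _ _ (`]0%R, +oo[%classic : set R)).
  - exact: measurable_itv.
  - move=> s; rewrite /J /= !in_itv /= andbT => /andP[s0 _].
    by rewrite (lt_le_trans _ s0) // expR_gt0.
  apply: open_continuous_measurable_fun; first exact: interval_open.
  by move=> s; rewrite inE /= in_itv /= andbT; exact: cg.
have E n : (\int[mu]_(s in J n) (f (ln s) / s)%:E = \int[mu]_(x in I n) (f x)%:E)%E.
  rewrite /J (@integration_by_substitution_increasing R expR (fun s => f (ln s) / s)).
  - apply: eq_integral => x _; congr EFin.
    transitivity (f (ln (expR x)) / expR x * expR^`()%classic x); first by [].
    by rewrite dexp expRK mulfVK // gt_eqF // expR_gt0.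
  - by rewrite -subr_ge0 opprK -natrD ler0n.
  - by move=> x y _ _ xy; rewrite ltr_expR.
  - by rewrite dexp => x _; exact: continuous_expR.
  - rewrite dexp; apply/cvg_ex; exists (expR (- n%:R)).
    by apply: cvg_at_right_filter; exact: continuous_expR.
  - rewrite dexp; apply/cvg_ex; exists (expR (n%:R)).
    by apply: cvg_at_left_filter; exact: continuous_expR.
  - split => [x _||]; first exact: derivable_expR.
      by apply: cvg_at_right_filter; exact: continuous_expR.
    by apply: cvg_at_left_filter; exact: continuous_expR.
  - apply: continuous_in_subspaceT => s; rewrite inE /= in_itv /= => /andP[s0 _].
    by apply: cg; rewrite (lt_le_trans _ s0) // expR_gt0.
have UI : \bigcup_n I n = setT by rewrite -(bigcup_itvT true false).
have UJ : \bigcup_n J n = `]0, +oo[%classic.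
  apply/seteqP; split => [s [n _]|s] /=; rewrite !in_itv /= andbT.
    rewrite /J /= in_itv /= => /andP[s0 _].
    by rewrite (lt_le_trans _ s0) // expR_gt0.
  move=> s0; have : (\bigcup_n I n) (ln s) by rewrite UI.
  move=> [n _]; rewrite /I /= in_itv /= => /andP[ns sn].
  exists n => //; rewrite /J /= in_itv /=.
  by rewrite -[s]lnK ?posrE // !ler_expR ns sn.
have h1 : (\int[mu]_(x in I i) (f x)%:E @[i --> \oo] --> \int[mu]_x (f x)%:E)%E.
  rewrite -UI; apply: ge0_nondecreasing_set_cvg_integral.
  - move=> m n mn; rewrite subsetEset => x; rewrite /I /= !in_itv /= -!ler_norml.
    by move=> /le_trans; apply; rewrite ler_nat.
  - by move=> i; exact: measurable_itv.
  - by move=> i; apply/measurable_EFinP; exact: measurable_funTS.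
  - by move=> i x _; rewrite lee_fin.
have h2 : (\int[mu]_(s in J i) (f (ln s) / s)%:E @[i --> \oo] -->
    \int[mu]_(s in `]0%R, +oo[) (f (ln s) / s)%:E)%E.
  rewrite -UJ; apply: ge0_nondecreasing_set_cvg_integral.
  - move=> m n mn; rewrite subsetEset => x; rewrite /J /= !in_itv /= => /andP[a b].
    by rewrite (le_trans _ a) ?(le_trans b) // ler_expR ?lerN2 ler_nat.
  - by move=> i; exact: measurable_itv.
  - by move=> i; apply/measurable_EFinP; exact: mg.
  - move=> i s; rewrite /J /= in_itv /= => /andP[s0 _].
    by rewrite lee_fin divr_ge0 // (le_trans _ s0) // expR_ge0.
rewrite (funext E) in h2.
by apply: (cvg_unique _ h2 h1); exact: ereal_hausdorff.
Qed.

Lemma Rintegral_ln (f : R -> R) : continuous f ->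
  \int[mu]_(s in `]0%R, +oo[) (f (ln s) / s) = \int[mu]_x f x.
Proof.
move=> cf.
have cm : continuous (fun x => Num.max (f x) 0).
  by move=> x; apply: continuous_max; [exact: cf|exact: cvg_cst].
have cn : continuous (fun x => Num.max (- f x) 0).
  move=> x; apply: (@continuous_max _ _ (fun x => - f x)); last exact: cvg_cst.
  by apply: cvgN; exact: cf.
rewrite /Rintegral integralE [in RHS]integralE; congr (fine (_ - _)%E).
  transitivity (\int[mu]_x (Num.max (f x) 0)%:E)%E; last first.
    by apply: eq_integral => x _; rewrite funeposE EFin_max.
  rewrite -(ge0_integral_ln cm); last by move=> x; rewrite le_max lexx orbT.
  apply: eq_integral => s; rewrite inE /= in_itv /= andbT => s0.
  by rewrite funeposE -EFin_max maxr_pMl ?mul0r // invr_ge0 ltW.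
transitivity (\int[mu]_x (Num.max (- f x) 0)%:E)%E; last first.
  by apply: eq_integral => x _; rewrite funenegE EFin_max.
rewrite -(ge0_integral_ln cn); last by move=> x; rewrite le_max lexx orbT.
apply: eq_integral => s; rewrite inE /= in_itv /= andbT => s0.
by rewrite funenegE -EFinN -EFin_max maxr_pMl ?mul0r ?mulNr // invr_ge0 ltW.
Qed.
End real_line.

(** * The Gamma function and the Beta integral *)

Section gamma_beta.
Context (R : realType).
Local Notation mu := (@lebesgue_measure R).
Implicit Types (z w : R[i]) (t v : R).

(** After s = e^t, Euler's integrand s^(z-1) e^-s becomes this function on the
    whole line, on which a dilation of s is a translation of t. *)
Definition gamma_kernel z t := cexp (z * t%:C - (expR t)%:C).

Lemma gamma_kernelE z t : z * t%:C - (expR t)%:C =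
  (complex.Re z * t - expR t) +i* (complex.Im z * t).
Proof.
case: z => a b; apply/eqP; rewrite eq_complex /=.
by apply/andP; split; apply/eqP; ring.
Qed.

Lemma normc_gamma_kernel z t :
  normc (gamma_kernel z t) = expR (complex.Re z * t - expR t).
Proof. by rewrite normc_cexp gamma_kernelE. Qed.

(** For negative t the bound holds already with K = 1. For positive t it says
    that 2 a t - e^t is bounded above; this is 1 + y <= e^y for
    y = t - ln (2 a), the maximum being reached at y = 0. *)
Lemma gamma_decay (a : R) : 0 < a ->
  exists K, forall t, expR (a * t - expR t) <= K * expR (- (a * `|t|)).
Proof.
move=> a0; pose m := Num.max 0 (2 * a * ln (2 * a) - 2 * a).
exists (expR m) => t; rewrite -expRD ler_expR.
have m0 : 0 <= m by rewrite le_max lexx.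
have m1 : 2 * a * ln (2 * a) - 2 * a <= m by rewrite le_max lexx orbT.
have [t0|t0] := leP 0 t.
  have h : 2 * a * (1 + (t - ln (2 * a))) <= expR t.
    have p : 0 < 2 * a by rewrite mulr_gt0.
    rewrite -[X in _ <= expR X](subrK (ln (2 * a))) expRD lnK ?posrE // mulrC.
    by rewrite ler_pM2r // expR_ge1Dx.
  by rewrite ger0_norm //; nra.
rewrite ltr0_norm //; have := expR_ge0 t; nra.
Qed.

Lemma cmeasurable_gamma_kernel z : cmeasurable (gamma_kernel z).
Proof.
apply: cmeasurable_cexp; split.
  apply: (@eq_measurable_fun _ _ _ _ _ (fun t => complex.Re z * t - expR t)).
    by move=> t _; rewrite /= gamma_kernelE.
  by apply: measurable_funB; [exact: measurable_funM|exact: measurable_expR].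
apply: (@eq_measurable_fun _ _ _ _ _ (fun t => complex.Im z * t)).
  by move=> t _; rewrite /= gamma_kernelE.
exact: measurable_funM.
Qed.

Lemma integrable_gamma_kernel (a : R) : 0 < a ->
  mu.-integrable setT (EFin \o (fun t => expR (a * t - expR t))).
Proof.
move=> a0; have [K hK] := gamma_decay a0.
apply: (integrable_decay (K := K) a0).
  apply: (measurableT_comp (@measurable_expR R)).
  by apply: measurable_funB; [exact: measurable_funM|exact: measurable_expR].
by move=> t; rewrite ger0_norm ?expR_ge0.
Qed.

Lemma cintegrable_gamma_kernel z : 0 < complex.Re z ->
  cintegrable mu (gamma_kernel z).
Proof.
move=> z0; apply: (cintegrable_dominated _ (integrable_gamma_kernel z0)).
  exact: cmeasurable_gamma_kernel.
by move=> t; rewrite normc_gamma_kernel.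
Qed.

Let Re_gk z t : complex.Re (gamma_kernel z t) =
  expR (complex.Re z * t - expR t) * cos (complex.Im z * t).
Proof. by rewrite Re_cexp gamma_kernelE. Qed.
Let Im_gk z t : complex.Im (gamma_kernel z t) =
  expR (complex.Re z * t - expR t) * sin (complex.Im z * t).
Proof. by rewrite Im_cexp gamma_kernelE. Qed.

Lemma gamma_kernelS z t : gamma_kernel (z + 1) t = (expR t)%:C * gamma_kernel z t.
Proof. by rewrite /gamma_kernel -cexp_real -cexpD; congr cexp; ring. Qed.

Let is_derive_Re_gk z t : is_derive t (1 : R)
  (fun t => complex.Re (gamma_kernel z t))
  (complex.Re (z * gamma_kernel z t - gamma_kernel (z + 1) t)).
Proof.
rewrite (_ : (fun t => complex.Re (gamma_kernel z t)) = (fun t =>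
  expR (complex.Re z * t - expR t) * cos (complex.Im z * t))); last first.
  by apply/funext => x; rewrite Re_gk.
apply: is_derive_eq.
rewrite gamma_kernelS cReB (cReM z) (cReM (expR t)%:C) Re_gk Im_gk /GRing.scale /=.
ring.
Qed.

Let is_derive_Im_gk z t : is_derive t (1 : R)
  (fun t => complex.Im (gamma_kernel z t))
  (complex.Im (z * gamma_kernel z t - gamma_kernel (z + 1) t)).
Proof.
rewrite (_ : (fun t => complex.Im (gamma_kernel z t)) = (fun t =>
  expR (complex.Re z * t - expR t) * sin (complex.Im z * t))); last first.
  by apply/funext => x; rewrite Im_gk.
apply: is_derive_eq.
rewrite gamma_kernelS cImB (cImM z) (cImM (expR t)%:C) Re_gk Im_gk /GRing.scale /=.
ring.
Qed.

Let is_derive_continuous (f df : R -> R) :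
  (forall x : R, is_derive x (1 : R) f (df x)) -> continuous f.
Proof.
move=> dF x; apply: differentiable_continuous.
by apply/derivable1_diffP; case: (dF x).
Qed.

Let continuous_Re_gk z : continuous (fun t => complex.Re (gamma_kernel z t)).
Proof. exact: is_derive_continuous (is_derive_Re_gk z). Qed.
Let continuous_Im_gk z : continuous (fun t => complex.Im (gamma_kernel z t)).
Proof. exact: is_derive_continuous (is_derive_Im_gk z). Qed.

Lemma cGammaE z : cGamma z = cintegral mu setT (gamma_kernel z).
Proof.
have E s : 0 < s -> cpow s (z - 1) * (expR (- s))%:C = gamma_kernel z (ln s) * (s^-1)%:C.
  move=> s0; rewrite /cpow /gamma_kernel lnK ?posrE //.
  rewrite -[s in (s^-1)%:C]lnK ?posrE // -expRN -!cexp_real -!cexpD; congr cexp.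
  by rewrite !rmorphN /=; ring.
rewrite /cGamma /cintegral -(Rintegral_ln (@continuous_Re_gk z)).
rewrite -(Rintegral_ln (@continuous_Im_gk z)).
congr (_ +i* _); apply: eq_Rintegral => s /set_mem s1.
  have s0 : 0 < s by move: s1; rewrite /= in_itv /= andbT.
  by rewrite E // cReMr.
have s0 : 0 < s by move: s1; rewrite /= in_itv /= andbT.
by rewrite E // cImMr.
Qed.

Let cvg_decay (c K : R) (f : R -> R) : 0 < c ->
  (forall x, `|f x| <= K * expR (- (c * `|x|))) ->
  f n%:R @[n --> \oo] --> (0 : R) /\ f (- n%:R) @[n --> \oo] --> (0 : R).
Proof.
move=> c0 fK.
have e0 : K * expR (- (c * n%:R)) @[n --> \oo] --> (0 : R).
  rewrite -[X in _ --> X](mulr0 K); apply: cvgM; first exact: cvg_cst.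
  apply: (cvg_comp (fun n => n%:R : R) (fun y => expR (- (c * y)))).
    exact: cvgr_idn.
  apply: (cvg_comp (fun y => c * y) (fun y => expR (- y))); last exact: cvgr_expR.
  exact: gt0_cvgMry.
split; apply: norm_cvg0; apply: (squeeze_cvgr _ (cvg_cst 0) e0).
  by apply: nearW => n; rewrite normr_ge0 /= (le_trans (fK _)) // ger0_norm.
by apply: nearW => n; rewrite normr_ge0 /= (le_trans (fK _)) // normrN ger0_norm.
Qed.

(** The derivative of [gamma_kernel z] is z times itself minus
    [gamma_kernel (z + 1)], and its integral is zero as the kernel vanishes at
    both ends of the line. *)
Lemma cGammaS z : 0 < complex.Re z -> cGamma (z + 1) = z * cGamma z.
Proof.
move=> z0; have z1 : 0 < complex.Re (z + 1) by rewrite cReD /= ltr_wpDr.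
have iz := cintegrable_gamma_kernel z0.
have iz1 := cintegrable_gamma_kernel z1.
have izz := cintegrableZ z iz.
apply/esym/eqP; rewrite -subr_eq0; apply/eqP.
rewrite !cGammaE -(cintegralZ z iz) -mulN1r -(cintegralZ (-1) iz1).
rewrite -(cintegralD izz (cintegrableZ (-1) iz1)).
pose f t := z * gamma_kernel z t - gamma_kernel (z + 1) t.
transitivity (cintegral mu setT f).
  by apply: eq_cintegral => t; rewrite /f mulN1r.
have [fr fi] : cintegrable mu f.
  apply: eq_cintegrable (cintegrableD izz (cintegrableZ (-1) iz1)) => t.
  by rewrite /f mulN1r.
have [K hK] := gamma_decay z0.
have hK1 t : normc (gamma_kernel z t) <= K * expR (- (complex.Re z * `|t|)).
  by rewrite normc_gamma_kernel.
have [r1 r2] := cvg_decay z0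
  (fun x => le_trans (Re_le_normc (gamma_kernel z x)) (hK1 x)).
have [i1 i2] := cvg_decay z0
  (fun x => le_trans (Im_le_normc (gamma_kernel z x)) (hK1 x)).
have cfr : continuous (fun t => complex.Re (f t)).
  rewrite (_ : (fun t => _) = (fun t =>
    complex.Re z * complex.Re (gamma_kernel z t) -
    complex.Im z * complex.Im (gamma_kernel z t) -
    complex.Re (gamma_kernel (z + 1) t))).
    move=> t; apply: cvgB; last exact: continuous_Re_gk.
    apply: cvgB; apply: cvgM; [exact: cvg_cst|exact: continuous_Re_gk
      |exact: cvg_cst|exact: continuous_Im_gk].
  by apply/funext => t; rewrite /f cReB (cReM z).
have cfi : continuous (fun t => complex.Im (f t)).
  rewrite (_ : (fun t => _) = (fun t =>
    complex.Re z * complex.Im (gamma_kernel z t) +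
    complex.Im z * complex.Re (gamma_kernel z t) -
    complex.Im (gamma_kernel (z + 1) t))).
    move=> t; apply: cvgB; last exact: continuous_Im_gk.
    apply: cvgD; apply: cvgM; [exact: cvg_cst|exact: continuous_Im_gk
      |exact: cvg_cst|exact: continuous_Re_gk].
  by apply/funext => t; rewrite /f cImB (cImM z).
rewrite /cintegral (Rintegral_derive cfr (is_derive_Re_gk z) fr r1 r2).
by rewrite (Rintegral_derive cfi (is_derive_Im_gk z) fi i1 i2).
Qed.

Lemma cGammaD_nat z m : 0 < complex.Re z ->
  cGamma (z + m%:R) = pochhammer z m * cGamma z.
Proof.
move=> z0; elim: m => [|m IH]; first by rewrite addr0 /pochhammer big_ord0 mul1r.
rewrite -natr1 addrA cGammaS; last first.
  by rewrite cReD ltr_wpDr // -(rmorph_nat (real_complex R)) /= ler0n.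
by rewrite IH /pochhammer big_ord_recr /=; ring.
Qed.

(** The integrand is at least exp (- e) on [0, 1]. *)
Lemma cGamma_neq0 (x : R) : 0 < x -> cGamma x%:C != 0.
Proof.
move=> x0; rewrite cGammaE.
have ix := integrable_gamma_kernel x0.
suff : 0 < complex.Re (cintegral mu setT (gamma_kernel x%:C)).
  by apply: contraTneq => ->; rewrite ltxx.
rewrite -[complex.Re _]/(\int[mu]_t complex.Re (gamma_kernel x%:C t)).
rewrite (_ : (fun t => _) = (fun t => expR (x * t - expR t))); last first.
  by apply/funext => t; rewrite Re_gk /= mul0r cos0 mulr1.
rewrite -lte_fin /Rintegral fineK; last exact: integrable_fin_num.
have mf : measurable_fun setT (fun t => (expR (x * t - expR t))%:E).
  exact: measurable_int ix.
apply: (@lt_le_trans _ _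
    (\int[mu]_(t in `[0%R, 1%R]) (expR (x * t - expR t))%:E)%E); last first.
  by apply: ge0_subset_integral => //; move=> t _; rewrite lee_fin expR_ge0.
apply: (@lt_le_trans _ _ (\int[mu]_(t in `[0%R, 1%R]) (expR (- expR 1))%:E)%E).
  rewrite integral_cst //= lebesgue_measure_itv /= lte_fin ltr01 -EFinB subr0 mule1.
  by rewrite lte_fin expR_gt0.
apply: ge0_le_integral => //.
- exact: measurable_funTS.
- move=> t /=; rewrite in_itv /= => /andP[t0 t1].
  rewrite lee_fin ler_expR -[leLHS]add0r lerD ?lerN2 ?ler_expR //.
  by rewrite mulr_ge0 // ltW.
Qed.

(** This is e^(z v) (1 + e^v)^-(z+w), which u = 1 / (1 + e^-v) maps to the usual
    integrand u^(z-1) (1 - u)^(w-1) of the Beta function. *)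
Definition beta_kernel z w v :=
  cexp (z * v%:C - (z + w) * (ln (1 + expR v))%:C).

Let ln1e_ge v : 0 <= ln (1 + expR v) /\ v <= ln (1 + expR v).
Proof.
have e0 := expR_gt0 v; split; first by rewrite ln_ge0 // lerDl ltW.
by rewrite -[leLHS]expRK ler_ln ?posrE ?addr_gt0 // lerDr.
Qed.

Let beta_kernelE z w v : z * v%:C - (z + w) * (ln (1 + expR v))%:C =
  (complex.Re z * v - (complex.Re z + complex.Re w) * ln (1 + expR v)) +i*
  (complex.Im z * v - (complex.Im z + complex.Im w) * ln (1 + expR v)).
Proof.
case: z w => [a b] [c d]; apply/eqP; rewrite eq_complex /=.
by apply/andP; split; apply/eqP; ring.
Qed.

Lemma normc_beta_kernel z w v : normc (beta_kernel z w v) =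
  expR (complex.Re z * v - (complex.Re z + complex.Re w) * ln (1 + expR v)).
Proof. by rewrite normc_cexp beta_kernelE. Qed.

Let measurable_ln1e : measurable_fun setT (fun v : R => ln (1 + expR v)).
Proof.
apply: (measurableT_comp (@measurable_ln R)).
by apply: measurable_funD => //; exact: measurable_expR.
Qed.

Lemma cmeasurable_beta_kernel z w : cmeasurable (beta_kernel z w).
Proof.
apply: cmeasurable_cexp; split.
  apply: (@eq_measurable_fun _ _ _ _ _ (fun v =>
      complex.Re z * v - (complex.Re z + complex.Re w) * ln (1 + expR v))).
    by move=> t _; rewrite /= beta_kernelE.
  by apply: measurable_funB; apply: measurable_funM.
apply: (@eq_measurable_fun _ _ _ _ _ (fun v =>
    complex.Im z * v - (complex.Im z + complex.Im w) * ln (1 + expR v))).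
  by move=> t _; rewrite /= beta_kernelE.
by apply: measurable_funB; apply: measurable_funM.
Qed.

(** As ln (1 + e^v) is at least 0 and at least v, the exponent
    a v - (a + b) ln (1 + e^v) is at most a v and at most - b v. *)
Lemma cintegrable_beta_kernel z w : 0 < complex.Re z -> 0 < complex.Re w ->
  cintegrable mu (beta_kernel z w).
Proof.
move=> z0 w0.
have c0 : 0 < Num.min (complex.Re z) (complex.Re w) by rewrite lt_min z0 w0.
apply: (cintegrable_dominated _ (integrable_exp_abs c0)).
  exact: cmeasurable_beta_kernel.
move=> v; rewrite normc_beta_kernel ler_expR.
have m1 : Num.min (complex.Re z) (complex.Re w) <= complex.Re z.
  by rewrite ge_min lexx.
have m2 : Num.min (complex.Re z) (complex.Re w) <= complex.Re w.
  by rewrite ge_min lexx orbT.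
have [l0 l1] := ln1e_ge v.
have [v0|v0] := leP 0 v; first by rewrite ger0_norm //; nra.
by rewrite ltr0_norm //; nra.
Qed.

(** With L = ln (1 + e^v) one has e^(v+t) + e^t = e^(t+L), so the product of
    the two kernels is a third one translated by L, up to a factor that does
    not depend on t. *)
Lemma gamma_kernel_mul z w t v :
  gamma_kernel z (v + t) * gamma_kernel w t =
  beta_kernel z w v * gamma_kernel (z + w) (t + ln (1 + expR v)).
Proof.
rewrite /gamma_kernel /beta_kernel -!cexpD; congr cexp.
rewrite !expRD lnK ?posrE ?addr_gt0 ?expR_gt0 //.
by rewrite !rmorphD /= !rmorphM /= !rmorphD /= rmorph1; ring.
Qed.

(** Integrate [gamma_kernel_mul] over the plane in both orders. *)
Lemma cGammaM z w : 0 < complex.Re z -> 0 < complex.Re w ->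
  cGamma z * cGamma w = cGamma (z + w) * cintegral mu setT (beta_kernel z w).
Proof.
move=> z0 w0; have zw0 : 0 < complex.Re (z + w) by rewrite cReD addr_gt0.
have iz := cintegrable_gamma_kernel z0.
have iw := cintegrable_gamma_kernel w0.
have izw := cintegrable_gamma_kernel zw0.
have ib := cintegrable_beta_kernel z0 w0.
pose H (p : R * R) := gamma_kernel z (p.2 + p.1) * gamma_kernel w p.1.
(* The modulus of H is the same function with z and w replaced by their real
   parts, so Tonelli for real parameters gives integrability. *)
have iH : cintegrable (mu \x mu)%E H.
  pose h (p : R * R) := expR (complex.Re z * (p.2 + p.1) - expR (p.2 + p.1)) *
    expR (complex.Re w * p.1 - expR p.1).
  have mg (a : R) : measurable_fun setT (fun t => expR (a * t - expR t)).
    apply: (measurableT_comp (@measurable_expR R)).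
    by apply: measurable_funB; [exact: measurable_funM|exact: measurable_expR].
  have madd : measurable_fun setT (fun p : R * R => p.2 + p.1).
    by apply: measurable_funD; [exact: measurable_snd|exact: measurable_fst].
  apply: (@cintegrable_dominated _ _ R (mu \x mu)%E H h).
  - apply: cmeasurableM.
      exact: (cmeasurable_comp (cmeasurable_gamma_kernel z) madd).
    exact: (cmeasurable_comp (cmeasurable_gamma_kernel w) measurable_fst).
  - apply/integrable12ltyP.
      apply/measurable_EFinP; apply: measurable_funM.
        exact: (measurableT_comp (mg _) madd).
      exact: (measurableT_comp (mg _) measurable_fst).
    apply: (@le_lt_trans _ _
        (\int[mu]_t ((\int[mu]_v expR (complex.Re z * v - expR v))%:E *
          (expR (complex.Re w * t - expR t))%:E))%E).
      rewrite le_eqVlt; apply/orP; left; apply/eqP/eq_integral => t _.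
      have ia := integrable_affine t ltr01 (integrable_gamma_kernel z0).
      rewrite (Rintegral_affine t ltr01 (integrable_gamma_kernel z0)) mul1r.
      rewrite /Rintegral fineK; last exact: integrable_fin_num ia.
      rewrite muleC -integralZl //; apply: eq_integral => v _.
      by rewrite -EFinM /h /= mul1r ger0_norm ?mulr_ge0 ?expR_ge0 // mulrC.
    have iw' := integrable_gamma_kernel w0.
    by rewrite integralZl // -(fineK (integrable_fin_num _ iw')) // -EFinM ltry.
  - by move=> p; rewrite /H /h normcM !normc_gamma_kernel.
have E1 t : cintegral mu setT (fun v => H (t, v)) = cGamma z * gamma_kernel w t.
  rewrite cGammaE -(cintegral_shift t iz) mulrC -cintegralZ.
    by apply: eq_cintegral => v; rewrite /H /= mulrC.
  exact: cintegrable_shift.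
have E2 v : cintegral mu setT (fun t => H (t, v)) = cGamma (z + w) * beta_kernel z w v.
  rewrite cGammaE -(cintegral_shift (ln (1 + expR v)) izw) mulrC -cintegralZ.
    by apply: eq_cintegral => t; rewrite /H /= gamma_kernel_mul.
  exact: cintegrable_shift.
transitivity (cintegral mu setT (fun t => cintegral mu setT (fun v => H (t, v)))).
  by rewrite (funext E1) cintegralZ // -cGammaE.
transitivity (cintegral mu setT (fun v => cintegral mu setT (fun t => H (t, v)))).
  apply: cintegral_Fubini => //.
    move=> t; have := cintegrableZ (gamma_kernel w t) (cintegrable_shift t iz).
    by apply: eq_cintegrable => v; rewrite /H /= mulrC.
  move=> v; have := cintegrableZ (beta_kernel z w v)
    (cintegrable_shift (ln (1 + expR v)) izw).
  by apply: eq_cintegrable => t; rewrite /H /= gamma_kernel_mul.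
by rewrite (funext E2) cintegralZ.
Qed.

End gamma_beta.

(** * Terminating hypergeometric series *)

Section terminating.

Lemma pochhammer_opp_nat (K : numFieldType) (N m : nat) : (N < m)%N ->
  pochhammer (- N%:R : K) m = 0.
Proof.
move=> Nm; rewrite /pochhammer (bigD1 (Ordinal Nm)) //= addrC subrr mul0r //.
Qed.

Lemma hypergeom_terminating (K : numFieldType) (s r : seq K) (x : K) (N : nat) :
  - N%:R \in s ->
  hypergeom s r x = \sum_(m < N.+1)
    (\prod_(a <- s) pochhammer a m) / (\prod_(b <- r) pochhammer b m)
      * (x ^+ m / m`!%:R).
Proof.
move=> Ns; rewrite /hypergeom.
set u := (fun m : nat => _).
rewrite (_ : \sum_(m < N.+1) _ = \sum_(0 <= m < N.+1) u m); last by rewrite big_mkord.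
apply: lim_near_cst; first exact: norm_hausdorff.
near=> n; have Nn : (N < n)%N by near: n; exact: nbhs_infty_gt.
rewrite /series /= (big_cat_nat _ Nn) //= [X in _ + X]big1_seq ?addr0 // => m.
rewrite mem_index_iota /= => /andP[Nm _].
by rewrite /u (big_rem _ Ns) /= pochhammer_opp_nat // !mul0r.
Unshelve. all: end_near. Qed.

Lemma pochhammer_real (R : realType) (x : R) n :
  pochhammer x%:C n = (pochhammer x n)%:C.
Proof.
rewrite /pochhammer rmorph_prod /=; apply: eq_bigr => i _.
by rewrite rmorphD /= rmorph_nat.
Qed.

Lemma pochhammer_gt0 (R : realType) (x : R) n : 0 < x -> 0 < pochhammer x n.
Proof. by move=> x0; apply: prodr_gt0 => i _; rewrite ltr_pwDl. Qed.
End terminating.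

(** * The one-dimensional Fourier transforms *)

Section one_dimensional.
Context (R : realType).
Local Notation mu := (@lebesgue_measure R).

Lemma cpow_real (x y : R) : 0 < x -> cpow x y%:C = (x `^ y)%:C.
Proof. by move=> x0; rewrite /cpow -rmorphM cexp_real /powR gt_eqF. Qed.

Lemma cpowD (x : R) (z w : R[i]) : cpow x (z + w) = cpow x z * cpow x w.
Proof. by rewrite /cpow mulrDl cexpD. Qed.

Definition laguerre_factor (N : nat) (al b : R) (k : nat) (t : R) : R :=
  laguerre N al (expR t) * expR t ^+ k * expR (- (expR t / 2) + b * t).

(* The summand exp (c t - e^t / 2), presented as a translate of the kernel of
   Gamma(c) so that its integral can be read off. *)
Let half_kernel (c : R[i]) (t : R) : R[i] :=
  cpow 2 c * gamma_kernel c (t - ln 2).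

Let half_kernelE c t : half_kernel c t = cexp (c * t%:C - (expR t / 2)%:C).
Proof.
rewrite /half_kernel /cpow /gamma_kernel -cexpD expRB lnK ?posrE //; congr cexp.
by rewrite rmorphB /=; ring.
Qed.

Lemma laguerre_factor_expand N al b k xi t :
  cexp (- 'i%C * (xi * t)%:C) * (laguerre_factor N al b k t)%:C =
  \sum_(m < N.+1)
   (pochhammer (al + 1) N / N`!%:R *
     (pochhammer (- N%:R) m / pochhammer (al + 1) m / m`!%:R))%:C *
   half_kernel ((b + k%:R)%:C - 'i%C * xi%:C + m%:R) t.
Proof.
rewrite /laguerre_factor /laguerre (@hypergeom_terminating _ _ _ _ N) ?mem_head //.
rewrite mulr_sumr !mulr_suml rmorph_sum mulr_sumr /=; apply: eq_bigr => m _.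
rewrite !big_cons !big_nil !mulr1.
have -> : half_kernel ((b + k%:R)%:C - 'i%C * xi%:C + m%:R) t =
  cexp (- 'i%C * (xi * t)%:C) *
    (expR t ^+ m * expR t ^+ k * expR (- (expR t / 2) + b * t))%:C.
  rewrite half_kernelE -!expRM_natl -!expRD -cexp_real -cexpD; congr cexp.
  rewrite !rmorphD !rmorphN !rmorphM /= !rmorph_nat.
  by ring.
rewrite !rmorphM /=; ring.
Qed.

Lemma fourier_laguerre_factor N al b k xi : 0 < b + k%:R ->
  let c := (b + k%:R)%:C - 'i%C * xi%:C in
  let f t := cexp (- 'i%C * (xi * t)%:C) * (laguerre_factor N al b k t)%:C in
  cintegrable mu f /\
  cintegral mu setT f =
    cpow 2 c * (pochhammer (al + 1)%:C N * cGamma c / N`!%:R) *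
    hypergeom [:: - N%:R; c] [:: (al + 1)%:C] 2.
Proof.
move=> bk0 c f.
have rec : complex.Re c = b + k%:R.
  by rewrite cReB cReM /= mul0r mulr0 subr0 subr0.
have rem (m : nat) : 0 < complex.Re (c + m%:R).
  by rewrite cReD rec -(rmorph_nat (real_complex R)) /= ltr_wpDr.
have ih (m : nat) : cintegrable mu (half_kernel (c + m%:R)).
  apply: cintegrableZ; apply: cintegrable_shift.
  exact: cintegrable_gamma_kernel.
have fE : f =1 (fun t => \sum_(m < N.+1)
   (pochhammer (al + 1) N / N`!%:R *
     (pochhammer (- N%:R) m / pochhammer (al + 1) m / m`!%:R))%:C *
   half_kernel (c + m%:R) t) by move=> t; exact: laguerre_factor_expand.
split.
  rewrite (funext fE); apply: cintegrable_sum => i; exact: cintegrableZ.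
rewrite (funext fE) cintegral_sum; last by move=> i; exact: cintegrableZ.
rewrite (@hypergeom_terminating _ _ _ _ N) ?mem_head // mulr_sumr.
apply: eq_bigr => m _; rewrite cintegralZ // /half_kernel cintegralZ; last first.
  by apply: cintegrable_shift; exact: cintegrable_gamma_kernel.
rewrite cintegral_shift; last exact: cintegrable_gamma_kernel.
rewrite -cGammaE cGammaD_nat ?rec // !big_cons !big_nil !mulr1 cpowD.
have -> : cpow 2 (m%:R : R[i]) = 2 ^+ m.
  rewrite -(rmorph_nat (real_complex R)) cpow_real // powR_mulrn // rmorphXn /=.
  by rewrite rmorph_nat.
rewrite !rmorphM /= !fmorphV /= !rmorph_nat -!pochhammer_real rmorphN rmorph_nat.
ring.
Qed.

Definition gegenbauer_factor (k : nat) (la A : R) (x : R) : R :=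
  (1 - tanh x ^+ 2) `^ A * gegenbauer k la (tanh x).

Lemma tanhE (x : R) : (1 - tanh x) / 2 = expR (- ln (1 + expR (2 * x))).
Proof.
have e0 := expR_gt0 x.
rewrite expRN lnK ?posrE ?addr_gt0 ?expR_gt0 //.
rewrite /tanh expRN expRM_natl; field.
by apply/andP; split; rewrite gt_eqF // ?addr_gt0 ?mulr_gt0 // exprn_gt0.
Qed.

Lemma sech2E (x : R) : 1 - tanh x ^+ 2 =
  expR (2 * ln 2 + 2 * x - 2 * ln (1 + expR (2 * x))).
Proof.
have e0 := expR_gt0 x.
rewrite expRB expRD !expRM_natl !lnK ?posrE ?addr_gt0 ?expR_gt0 // ?exprn_gt0 //.
rewrite /tanh expRN; field.
by apply/andP; split; rewrite gt_eqF // ?addr_gt0 ?mulr_gt0 // exprn_gt0.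
Qed.

Lemma sech2_gt0 (x : R) : 0 < 1 - tanh x ^+ 2.
Proof. by rewrite sech2E expR_gt0. Qed.

Lemma gegenbauer_factor_expand k la A xi x :
  cexp (- 'i%C * (xi * x)%:C) * (gegenbauer_factor k la A x)%:C =
  \sum_(m < k.+1)
   (2 `^ (2 * A) * (pochhammer (2 * la) k / k`!%:R *
     (pochhammer (- k%:R) m * pochhammer (k%:R + 2 * la) m /
      pochhammer (la + 2^-1) m / m`!%:R)))%:C *
   beta_kernel (A%:C - 'i%C * xi%:C / 2) (A%:C + 'i%C * xi%:C / 2 + m%:R)
     (2 * x + 0).
Proof.
rewrite /gegenbauer_factor /gegenbauer (@hypergeom_terminating _ _ _ _ k) ?mem_head //.
rewrite !mulr_sumr rmorph_sum mulr_sumr /=; apply: eq_bigr => m _.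
rewrite !big_cons !big_nil !mulr1 addr0.
have E : cexp (- 'i%C * (xi * x)%:C) *
    ((1 - tanh x ^+ 2) `^ A * ((1 - tanh x) / 2) ^+ m)%:C =
  (2 `^ (2 * A))%:C * beta_kernel (A%:C - 'i%C * xi%:C / 2)
    (A%:C + 'i%C * xi%:C / 2 + m%:R) (2 * x).
  rewrite sech2E tanhE -expRM -expRM_natl -expRD [2 `^ _]/powR pnatr_eq0 /=.
  rewrite -!cexp_real -!cexpD; congr cexp.
  rewrite !(rmorphD, rmorphN, rmorphM) /= !rmorph_nat.
  by field.
transitivity (cexp (- 'i%C * (xi * x)%:C) *
    ((1 - tanh x ^+ 2) `^ A * ((1 - tanh x) / 2) ^+ m)%:C *
   (pochhammer (2 * la) k / k`!%:R *
     (pochhammer (- k%:R) m * pochhammer (k%:R + 2 * la) m /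
      pochhammer (la + 2^-1) m / m`!%:R))%:C).
  rewrite -[RHS]mulrA -(rmorphM (real_complex R)) /=.
  by congr (_ * (real_complex R) _); ring.
by rewrite E [in RHS]rmorphM /=; ring.
Qed.

(** The m-th kernel in [gegenbauer_factor_expand] integrates to half of
    Gamma(z) Gamma(w + m) / Gamma(2 A + m), that is
    B(w, z) (w)_m / (2 A)_m / 2. *)
Lemma fourier_gegenbauer_factor k la A xi : 0 < A ->
  let w := A%:C + 'i%C * xi%:C / 2 in
  let z := A%:C - 'i%C * xi%:C / 2 in
  let f x := cexp (- 'i%C * (xi * x)%:C) * (gegenbauer_factor k la A x)%:C in
  cintegrable mu f /\
  cintegral mu setT f =
    cpow 2 (2 * A - 1)%:C * (pochhammer (2 * la) k / k`!%:R)%:C *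
    (cBeta w z * hypergeom [:: - k%:R; k%:R + (2 * la)%:C; w]
        [:: (la + 2^-1)%:C; (2 * A)%:C] 1).
Proof.
move=> A0 w z f.
have hi : 'i%C * xi%:C / 2 = 0 +i* (xi / 2).
  have -> : 2 = (2 : R)%:C :> R[i] by rewrite rmorph_nat.
  rewrite -fmorphV /=; apply/eqP; rewrite eq_complex /=.
  by apply/andP; split; apply/eqP; ring.
have rew : complex.Re w = A by rewrite /w hi cReD /= addr0.
have rez : complex.Re z = A by rewrite /z hi cReB /= subr0.
have rewm (m : nat) : 0 < complex.Re (w + m%:R).
  by rewrite cReD rew -(rmorph_nat (real_complex R)) /= ltr_wpDr.
have rez0 : 0 < complex.Re z by rewrite rez.
have wz (m : nat) : z + (w + m%:R) = (2 * A)%:C + m%:R.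
  by rewrite /w /z rmorphM rmorph_nat; ring.
have ib (m : nat) := cintegrable_affine 0 (ltr0n R 2)
  (cintegrable_beta_kernel rez0 (rewm m)).
have fE := fun x => gegenbauer_factor_expand k la A xi x.
split.
  by rewrite /f (funext fE); apply: cintegrable_sum => i; exact: cintegrableZ.
rewrite /f (funext fE) cintegral_sum; last by move=> i; exact: cintegrableZ.
rewrite (@hypergeom_terminating _ _ _ _ k) ?mem_head // !mulr_sumr.
apply: eq_bigr => m _; rewrite cintegralZ // !big_cons !big_nil !mulr1.
have gA0 : cGamma (2 * A)%:C != 0 by rewrite cGamma_neq0 // mulr_gt0.
have pA0 : pochhammer (2 * A)%:C m != 0.
  rewrite pochhammer_real (fmorph_eq0 (real_complex R)) gt_eqF //.
  by rewrite pochhammer_gt0 // mulr_gt0.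
have two0 : (2 : R[i]) != 0 by rewrite pnatr_eq0.
have re2A : 0 < complex.Re (2 * A)%:C by rewrite /= mulr_gt0.
have -> : cintegral mu setT (fun x => beta_kernel z (w + m%:R) (2 * x + 0)) =
   2^-1 * (pochhammer w m * cGamma w * cGamma z /
     (pochhammer (2 * A)%:C m * cGamma (2 * A)%:C)).
  have := cGammaM rez0 (rewm m).
  rewrite (cintegral_affine 0 (ltr0n R 2) (cintegrable_beta_kernel rez0 (rewm m))).
  rewrite wz !cGammaD_nat ?rew // rmorph_nat => H.
  apply: (mulfI two0); apply: (mulfI pA0); apply: (mulfI gA0).
  transitivity (cGamma z * (pochhammer w m * cGamma w)); first by rewrite H; ring.
  by field; rewrite gA0 pA0.
have -> : cBeta w z = cGamma w * cGamma z / cGamma (2 * A)%:C.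
  by rewrite /cBeta (addrC w) -[w in z + w]addr0 (wz 0%N) addr0.
have -> : cpow 2 (2 * A - 1)%:C = (2 `^ (2 * A))%:C / 2.
  rewrite rmorphB cpowD cpow_real //; congr (_ * _).
  by rewrite -rmorphN cpow_real // powR_inv1 // fmorphV rmorph_nat.
rewrite expr1n !rmorphM /= !fmorphV /= !rmorph_nat -!pochhammer_real.
rewrite rmorphN !rmorphD /= !rmorph_nat fmorphV rmorph_nat !rmorphM /= rmorph_nat !invfM.
by ring.
Qed.
End one_dimensional.

(** * Products of functions of one variable *)

Section tuple_product.
Context (R : realType).
Local Notation mu := (@lebesgue_measure R).

Lemma cintegral_cons_measure n
    (nu : {sigma_finite_measure set (n.-tuple (measurableTypeR R)) -> \bar R})
    (f : n.+1.-tuple (measurableTypeR R) -> R[i]) :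
  cmeasurable f -> cintegrable (mu \x nu)%E (f \o @tcons _ _ _) ->
  cintegrable (cons_measure mu nu) f /\
  cintegral (cons_measure mu nu) setT f =
    cintegral (mu \x nu)%E setT (f \o @tcons _ _ _).
Proof.
move=> [mr mi] [fr fi].
have mt := @measurable_tcons _ (measurableTypeR R) n.
split.
  split.
    apply: (integrable_pushforward mt _ fr) => //; exact/measurable_EFinP.
  apply: (integrable_pushforward mt _ fi) => //; exact/measurable_EFinP.
rewrite /cintegral /Rintegral; congr (fine _ +i* fine _).
  rewrite (integral_pushforward mt _ fr) //; exact/measurable_EFinP.
rewrite (integral_pushforward mt _ fi) //; exact/measurable_EFinP.
Qed.

Lemma cintegral_lebesgue_tuple n (F : 'I_n -> R -> R[i]) :
  (forall j, cintegrable mu (F j)) ->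
  let f (z : n.-tuple (measurableTypeR R)) := \prod_(j < n) F j (tnth z j) in
  cintegrable (lebesgue_tuple R n) f /\
  cintegral (lebesgue_tuple R n) setT f = \prod_(j < n) cintegral mu setT (F j).
Proof.
elim: n F => [|n IH] F iF f.
  have fE : f = fun=> 1 by apply/funext => z; rewrite /f big_ord0.
  rewrite fE big_ord0 /cintegral /Rintegral !integral_dirac //= indicT mul1r mulr0.
  by split => //; split; apply: finite_measure_integrable_cst.
have mf : cmeasurable f.
  apply: cmeasurable_prod => j.
  apply: (cmeasurable_comp (cintegrable_cmeasurable (iF j))).
  exact: measurable_tnth.
have [ig Ig] := IH (fun j => F (lift ord0 j)) (fun j => iF (lift ord0 j)).
have fE : f \o @tcons _ (measurableTypeR R) n = fun p => F ord0 p.1 *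
    \prod_(j < n) F (lift ord0 j) (tnth p.2 j).
  apply/funext => p; rewrite /f /= big_ord_recl tnth0; congr (_ * _).
  by apply: eq_bigr => j _; rewrite tnthS.
have it := cintegrable_tensor (iF ord0) ig.
have [ic Ic] := cintegral_cons_measure mf
  (eq_cintegrable (fun p => esym (congr1 (@^~ p) fE)) it).
by split => //; rewrite [LHS]Ic fE (cintegral_tensor (iF ord0) ig) Ig big_ord_recl.
Qed.
End tuple_product.

(** * Separation of variables on the cone *)

Section separation.
Context (R : realType) (d : nat).
Implicit Types (k : 'I_d -> nat) (x : 'I_d -> R) (j : 'I_d).

(** The total exponent of 1 - tanh^2 x_j in the integrand: the explicit factor
    contributes a + (d - j) / 4, and the ball polynomial contributes the rest. *)
Definition gegen_weight (a : R) k j : R := a + codim R j / 4 + (ktail k j)%:R / 2.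

Lemma sqrtr_prod (I : finType) (P : pred I) (s : I -> R) :
  (forall i, 0 < s i) ->
  Num.sqrt (\prod_(i | P i) s i) = \prod_(i | P i) Num.sqrt (s i).
Proof.
move=> s0.
suff [] : 0 < \prod_(i | P i) s i /\
  Num.sqrt (\prod_(i | P i) s i) = \prod_(i | P i) Num.sqrt (s i) by [].
apply: (big_ind2 (fun u v => 0 < u /\ Num.sqrt u = v)) => //.
  by rewrite sqrtr1.
by move=> u1 v1 u2 v2 [u10 <-] [u20 <-]; rewrite mulr_gt0 // sqrtrM // ltW.
Qed.

Lemma powR_prod (I : finType) (P : pred I) (s : I -> R) (p : R) :
  (forall i, 0 < s i) ->
  (\prod_(i | P i) s i) `^ p = \prod_(i | P i) s i `^ p.
Proof.
move=> s0.
suff [] : 0 < \prod_(i | P i) s i /\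
  (\prod_(i | P i) s i) `^ p = \prod_(i | P i) s i `^ p by [].
apply: (big_ind2 (fun u v => 0 < u /\ u `^ p = v)) => //.
  by rewrite powR1.
by move=> u1 v1 u2 v2 [u10 <-] [u20 <-]; rewrite mulr_gt0 // powRM // ltW.
Qed.

Lemma powR_sum (I : finType) (P : pred I) (p : I -> R) (s : R) :
  0 < s -> s `^ (\sum_(i | P i) p i) = \prod_(i | P i) s `^ p i.
Proof.
move=> s0; apply: (big_morph (fun q => s `^ q)); last exact: powRr0.
by move=> u v; rewrite powRD //; apply/implyP => _; rewrite gt_eqF.
Qed.

(** The product telescopes: with s_i = 1 - u_i^2, each term of the sum is
    (1 - s_i) s_1 ... s_(i-1). *)
Lemma spherical_sum (u : 'I_d -> R) (m : nat) : (m <= d)%N ->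
  (forall i, 0 < 1 - u i ^+ 2) ->
  1 - \sum_(i < d | (i < m)%N)
    (u i * \prod_(l < d | (l < i)%N) Num.sqrt (1 - u l ^+ 2)) ^+ 2 =
  \prod_(i < d | (i < m)%N) (1 - u i ^+ 2).
Proof.
move=> md u0; elim: m md => [|m IH] md; first by rewrite !big_pred0 // subr0.
have P (i : 'I_d) : (i < m.+1)%N && (i != Ordinal md) = (i < m)%N.
  by rewrite ltnS [RHS]ltn_neqAle andbC.
rewrite (bigD1 (Ordinal md)) //= [RHS](bigD1 (Ordinal md)) //=.
rewrite !(eq_bigl _ _ P) -IH ?(ltnW md) //.
rewrite exprMn -sqrtr_prod // sqr_sqrtr; last first.
  by apply: prodr_ge0 => i _; exact: ltW.
by rewrite -IH ?(ltnW md) //; ring.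
Qed.

(** The factors (s_1 ... s_(j-1))^(k_j / 2) are regrouped by exchanging the two
    products: s_i occurs once for each j > i, with total exponent the half of
    the tail of k after i. *)
Lemma ball_poly_separates (mu : R) k x (t : R) :
  ball_poly mu k (fun j => tau x t j / expR t) =
  \prod_(j < d) ((1 - tanh (x j) ^+ 2) `^ ((ktail k j)%:R / 2) *
    gegenbauer (k j) (gegen_index mu k j) (tanh (x j))).
Proof.
have s0 i : 0 < 1 - tanh (x i) ^+ 2 by exact: sech2_gt0.
have tauE j : tau x t j / expR t =
    tanh (x j) * \prod_(i < d | (i < j)%N) Num.sqrt (1 - tanh (x i) ^+ 2).
  by rewrite /tau; field; rewrite gt_eqF // expR_gt0.
have sqE j : 1 - sqnorm_before (fun j => tau x t j / expR t) j =
    \prod_(i < d | (i < j)%N) (1 - tanh (x i) ^+ 2).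
  rewrite -(@spherical_sum (fun i => tanh (x i))) ?(ltnW (ltn_ord j)) //.
  by congr (1 - _); apply: eq_bigr => i _; rewrite tauE.
have sP j : 0 < \prod_(i < d | (i < j)%N) (1 - tanh (x i) ^+ 2) by exact: prodr_gt0.
rewrite /ball_poly [LHS]big_split [RHS]big_split /=; congr (_ * _); last first.
  apply: eq_bigr => j _; congr gegenbauer; rewrite sqE tauE -sqrtr_prod //.
  by rewrite mulfK // gt_eqF // sqrtr_gt0.
under eq_bigr do rewrite sqE powR_prod //.
rewrite (exchange_big_dep xpredT) //=; apply: eq_bigr => i _.
rewrite -powR_sum // /ktail natr_sum mulr_suml.
by congr powR; apply: eq_bigl.
Qed.

Lemma gfun_separates (n : nat) k (t : R) x (a b beta mu : R) :
  gfun n k t x a b beta mu =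
  (\prod_(j < d) gegenbauer_factor (k j) (gegen_index mu k j)
                   (gegen_weight a k j) (x j)) *
  laguerre_factor (n - ksum k) (2 * (ksum k)%:R + 2 * mu + beta + d%:R - 1)
    b (ksum k) t.
Proof.
rewrite /gfun /cone_laguerre ball_poly_separates /laguerre_factor.
have -> : \prod_(j < d) gegenbauer_factor (k j) (gegen_index mu k j)
                          (gegen_weight a k j) (x j) =
  (\prod_(j < d) (1 - tanh (x j) ^+ 2) `^ (a + codim R j / 4)) *
  \prod_(j < d) ((1 - tanh (x j) ^+ 2) `^ ((ktail k j)%:R / 2) *
    gegenbauer (k j) (gegen_index mu k j) (tanh (x j))).
  rewrite -big_split /=; apply: eq_bigr => j _.
  rewrite /gegenbauer_factor /gegen_weight powRD ?mulrA //.
  by apply/implyP => _; rewrite gt_eqF // sech2_gt0.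
by ring.
Qed.

Lemma sum_codim : \sum_(j < d) codim R j = d%:R * (d%:R - 1) / 2.
Proof.
rewrite /codim; elim: d => [|m IH]; first by rewrite big_ord0 !mul0r.
rewrite big_ord_recl subn1 /= (eq_bigr (fun j : 'I_m => (m - j.+1)%N%:R)) //.
by rewrite IH -natr1; field.
Qed.

Lemma sum_ktail k : (\sum_(j < d) ktail k j = \sum_(j < d) j * k j)%N.
Proof.
rewrite /ktail (exchange_big_dep xpredT) //=; apply: eq_bigr => i _.
rewrite -(big_ord_widen d (fun=> k i)) ?(ltnW (ltn_ord i)) //.
by rewrite sum_nat_const card_ord.
Qed.

Lemma gegen_weight_gt0 (a : R) k j : 0 < a -> 0 < gegen_weight a k j.
Proof.
by move=> a0; rewrite /gegen_weight /codim ltr_wpDr ?divr_ge0 // ltr_wpDr // divr_ge0.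
Qed.

(** The exponent of 2 in the theorem: the j-th one-dimensional transform carries
    the factor 2^(2 A_j - 1), with A_j the weight. *)
Lemma sum_gegen_weight (a : R) k :
  \sum_(j < d) (2 * gegen_weight a k j - 1) =
  2 * a * d%:R + d%:R * (d%:R - 5) / 4 + \sum_(j < d) (j * k j)%N%:R.
Proof.
rewrite -natr_sum -sum_ktail natr_sum.
transitivity (\sum_(j < d) (2 * a - 1) + 2^-1 * \sum_(j < d) codim R j +
  \sum_(j < d) (ktail k j)%:R).
  rewrite mulr_sumr -!big_split /=; apply: eq_bigr => j _.
  by rewrite /gegen_weight; field.
by rewrite sum_codim sumr_const card_ord -mulr_natr; field.
Qed.

Lemma theta_argE (a : R) k j (xi : R) :
  theta_arg a k j xi = (gegen_weight a k j)%:C + 'i%C * xi%:C / 2.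
Proof.
rewrite /theta_arg /gegen_weight !(rmorphD, rmorphM, fmorphV) /= !rmorph_nat.
by field.
Qed.

Lemma theta_argN (a : R) k j (xi : R) :
  theta_arg a k j (- xi) = (gegen_weight a k j)%:C - 'i%C * xi%:C / 2.
Proof. by rewrite theta_argE rmorphN /= mulrN mulNr. Qed.

Lemma ThetaFE (a mu : R) k j (xi : R) :
  let w := (gegen_weight a k j)%:C + 'i%C * xi%:C / 2 in
  let z := (gegen_weight a k j)%:C - 'i%C * xi%:C / 2 in
  ThetaF a mu k j xi = cBeta w z *
    hypergeom [:: - (k j)%:R; (k j)%:R + (2 * gegen_index mu k j)%:C; w]
      [:: (gegen_index mu k j + 2^-1)%:C; (2 * gegen_weight a k j)%:C] 1.
Proof.
move=> w z; rewrite /ThetaF theta_argN theta_argE.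
have -> : (ktail k j)%:R + mu + codim R j / 2 = gegen_index mu k j.
  by rewrite /gegen_index; ring.
have -> : (ktail k j)%:R + mu + (codim R j + 1) / 2 = gegen_index mu k j + 2^-1.
  by rewrite /gegen_index; field.
have -> : (ktail k j)%:R + 2 * a + codim R j / 2 = 2 * gegen_weight a k j.
  by rewrite /gegen_weight; field.
by [].
Qed.

Lemma ThetaF_continuous_hahn (a mu : R) k j (s : R) :
  0 < a -> - 2^-1 < mu ->
  ThetaF a mu k j s =
      (k j)`!%:R
      / ('i%C ^+ k j
         * pochhammer ((ktail k j)%:R + mu + (codim R j + 1) / 2)%:C (k j)
         * pochhammer ((ktail k j)%:R + 2 * a + codim R j / 2)%:C (k j))
      * cBeta (theta_arg a k j s) (theta_arg a k j (- s))
      * (let A := (a + (ktail k j)%:R / 2 + codim R j / 4)%:C in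
         let M := (mu - a + ((ktail k j)%:R + 1) / 2 + codim R j / 4)%:C in
         continuous_hahn (k j) (s / 2)%:C A M M A).
Proof.
move=> a0 mu0.
pose A := (a + (ktail k j)%:R / 2 + codim R j / 4)%:C.
pose M := (mu - a + ((ktail k j)%:R + 1) / 2 + codim R j / 4)%:C.
rewrite -[X in _ = _ * X]/(continuous_hahn (k j) (s / 2)%:C A M M A).
have AM : A + M = ((ktail k j)%:R + mu + (codim R j + 1) / 2)%:C.
  by rewrite -(rmorphD (real_complex R)) /=; congr (_%:C); field.
have AA : A + A = ((ktail k j)%:R + 2 * a + codim R j / 2)%:C.
  by rewrite -(rmorphD (real_complex R)) /=; congr (_%:C); field.
have up : (k j)%:R + A + M + M + A - 1 =
    (k j)%:R + (2 * ((ktail k j)%:R + mu + codim R j / 2))%:C.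
  rewrite -!addrA; congr (_ + _).
  rewrite -(rmorph1 (real_complex R)) -rmorphN -!rmorphD.
  by congr ((real_complex R) _); field.
have th : A + 'i%C * (s / 2)%:C = theta_arg a k j s.
  rewrite theta_argE rmorphM fmorphV rmorph_nat mulrA; congr (_ + _).
  by congr ((real_complex R) _); rewrite /gegen_weight; ring.
have k0 : 0 <= (ktail k j)%:R :> R by [].
have c0 : 0 <= codim R j by rewrite /codim.
rewrite /continuous_hahn AM AA up th /ThetaF.
have p1 : pochhammer ((ktail k j)%:R + mu + (codim R j + 1) / 2)%:C (k j) != 0.
  rewrite pochhammer_real (fmorph_eq0 (real_complex R)) gt_eqF // pochhammer_gt0 //; lra.
have p2 : pochhammer ((ktail k j)%:R + 2 * a + codim R j / 2)%:C (k j) != 0.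
  rewrite pochhammer_real (fmorph_eq0 (real_complex R)) gt_eqF // pochhammer_gt0 //; lra.
have f0 : (k j)`!%:R != 0 :> R[i] by rewrite pnatr_eq0 -lt0n fact_gt0.
have i0 : 'i%C ^+ k j != 0 :> R[i].
  by rewrite expf_neq0 // eq_complex /= oner_eq0 andbF.
by field; rewrite p1 p2 f0 i0.
Qed.
End separation.

(* A point of R^(d+1) is the tuple (x_1, ..., x_d, t), and likewise
   xi = (xi_1, ..., xi_(d+1)). Indices in 'I_d start at 0, so the usual
   sum of j k_(j+1) over 1 <= j <= d - 1 is the sum of j * k j below. *)
Theorem theorem3p2 (R : realType) (d : nat) (k : 'I_d -> nat) (n : nat)
    (a b beta mu : R)
    (hd : (1 <= d)%N) (hn : (ksum k <= n)%N)
    (ha : 0 < a) (hb : 0 < b + (ksum k)%:R) (hmu : - 2^-1 < mu)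
    (hbeta : 0 < 2 * (ksum k)%:R + 2 * mu + beta + d%:R) :
  let x (z : d.+1.-tuple R) (j : 'I_d) := tnth z (widen_ord (leqnSn d) j) in
  let t (z : d.+1.-tuple R) := tnth z ord_max in
  let g (z : d.+1.-tuple R) := gfun n k (t z) (x z) a b beta mu in
  (lebesgue_tuple R d.+1).-integrable setT (fun z => (g z)%:E) /\
  (forall xi : d.+1.-tuple R,
    fourier (fun z => (g z)%:C) xi =
      cpow 2 ((b + (ksum k)%:R)%:C - 'i%C * (t xi)%:C
              + (2 * a * d%:R + d%:R * (d%:R - 5) / 4
                 + \sum_(j < d) (j * k j)%N%:R)%:C)
      * (pochhammer (2 * (ksum k)%:R + 2 * mu + beta + d%:R)%:C (n - ksum k)
         * cGamma ((b + (ksum k)%:R)%:C - 'i%C * (t xi)%:C)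
         / (n - ksum k)`!%:R)
      * (\prod_(j < d)
          ((pochhammer (2 * ((ktail k j)%:R + mu + codim R j / 2)) (k j)
            / (k j)`!%:R)%:C
           * ThetaF a mu k j (x xi j)))
      * LambdaF n k b mu beta (t xi)) /\
  (forall (j : 'I_d) (s : R),
    ThetaF a mu k j s =
      (k j)`!%:R
      / ('i%C ^+ k j
         * pochhammer ((ktail k j)%:R + mu + (codim R j + 1) / 2)%:C (k j)
         * pochhammer ((ktail k j)%:R + 2 * a + codim R j / 2)%:C (k j))
      * cBeta (theta_arg a k j s) (theta_arg a k j (- s))
      * (let A := (a + (ktail k j)%:R / 2 + codim R j / 4)%:C in
         let M := (mu - a + ((ktail k j)%:R + 1) / 2 + codim R j / 4)%:C in
         continuous_hahn (k j) (s / 2)%:C A M M A)).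
Proof.
move=> x t g.
pose N := (n - ksum k)%N.
pose al : R := 2 * (ksum k)%:R + 2 * mu + beta + d%:R - 1.
pose F (xi : d.+1.-tuple R) (j : 'I_d.+1) (y : R) : R[i] :=
  if unlift ord_max j is Some i then
    cexp (- 'i%C * (x xi i * y)%:C) *
      (gegenbauer_factor (k i) (gegen_index mu k i) (gegen_weight a k i) y)%:C
  else cexp (- 'i%C * (t xi * y)%:C) * (laguerre_factor N al b (ksum k) y)%:C.
have widenE (i : 'I_d) : widen_ord (leqnSn d) i = lift ord_max i.
  by apply/val_inj; rewrite /= /bump leqNgt ltn_ord.
have Fw xi i y : F xi (widen_ord (leqnSn d) i) y = cexp (- 'i%C * (x xi i * y)%:C) *
      (gegenbauer_factor (k i) (gegen_index mu k i) (gegen_weight a k i) y)%:C.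
  by rewrite /F widenE liftK.
have Fm xi y : F xi ord_max y =
    cexp (- 'i%C * (t xi * y)%:C) * (laguerre_factor N al b (ksum k) y)%:C.
  by rewrite /F unlift_none.
have FX xi i := @fourier_gegenbauer_factor R (k i) (gegen_index mu k i)
  (gegen_weight a k i) (x xi i) (gegen_weight_gt0 k i ha).
have FT xi := @fourier_laguerre_factor R N al b (ksum k) (t xi) hb.
have iF xi j : cintegrable (@lebesgue_measure R) (F xi j).
  have [i ->|->] := unliftP ord_max j.
    rewrite -widenE (funext (Fw xi i)); exact: (FX xi i).1.
  rewrite (funext (Fm xi)); exact: (FT xi).1.
have prodF xi (z : d.+1.-tuple R) : \prod_(j < d.+1) F xi j (tnth z j) =
    cexp (- 'i%C * (\sum_(j < d.+1) tnth xi j * tnth z j)%:C) * (g z)%:C.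
  rewrite rmorph_sum mulr_sumr cexp_sum /g gfun_separates rmorphM rmorph_prod /=.
  rewrite !big_ord_recr /= Fm mulrACA -big_split /=.
  by congr (_ * _); apply: eq_bigr => j _; rewrite Fw.
have tuplei xi := cintegral_lebesgue_tuple (iF xi).
split; [|split].
- (* At frequency zero the exponential is 1 and the product is g itself. *)
  have [[ir _] _] := tuplei [tuple (0 : R) | _ < d.+1].
  apply: (eq_integrable measurableT _ _ _ ir) => z _ /=; congr EFin.
  rewrite prodF big1 ?mulr0 ?cexp0 ?mul1r // => j _.
  by rewrite tnth_mktuple mul0r.
- move=> xi; have [_ It] := tuplei xi.
  transitivity (cintegral (lebesgue_tuple R d.+1) setT
    (fun z => \prod_(j < d.+1) F xi j (tnth z j))).
    by apply: eq_cintegral => z; rewrite prodF.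
  rewrite It big_ord_recr /=.
  rewrite (funext (Fm xi)) (FT xi).2.
  under eq_bigr do rewrite (funext (Fw _ _)) (FX _ _).2 -ThetaFE -mulrA.
  rewrite big_split /=.
  have -> : \prod_(j < d) cpow 2 (2 * gegen_weight a k j - 1)%:C =
      cpow 2 (2 * a * d%:R + d%:R * (d%:R - 5) / 4 + \sum_(j < d) (j * k j)%N%:R)%:C.
    rewrite -sum_gegen_weight rmorph_sum.
    by rewrite /cpow mulr_suml cexp_sum.
  rewrite cpowD /LambdaF /al subrK.
  have -> : - n%:R + (ksum k)%:R = - (n - ksum k)%:R :> R[i].
    by rewrite natrB // opprB addrC.
  have -> : \prod_(j < d) ((pochhammer (2 * gegen_index mu k j) (k j) /
         (k j)`!%:R)%:C * ThetaF a mu k j (x xi j)) =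
      \prod_(j < d)
          ((pochhammer (2 * ((ktail k j)%:R + mu + codim R j / 2)) (k j)
            / (k j)`!%:R)%:C
           * ThetaF a mu k j (x xi j)).
    apply: eq_bigr => j _; congr ((pochhammer (2 * _) _ / _)%:C * _).
    by rewrite /gegen_index; ring.
  by rewrite /N; ring.
- by move=> j s; exact: ThetaF_continuous_hahn.
Qed.
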